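(* Let $X$ be an irreducible affine variety over $\mathbb{C}$ and $\mathcal{F}$ an algebraic foliation on $X$. Then the function $n_{\mathcal{F}}:X\to\mathbb{N}$, $x\mapsto \dim V(\mathcal{F},x)$, is measurable for the Zariski topology. Moreover, there exists an integer $p$ such that (1) $n_{\mathcal{F}}(x)\le p$ for every point $x\in X$, and (2) $n_{\mathcal{F}}(x)=p$ for every very generic point $x\in X$.
   Context: $\mathcal{O}_X$ denotes the ring of regular functions on $X$. An algebraic foliation $\mathcal{F}$ on $X$ is a collection of algebraic vector fields on $X$, viewed as $\mathbb{C}$-derivations of $\mathcal{O}_X$, which is stable under Lie bracket. For a Zariski closed subset $Y\subseteq X$ with vanishing ideal $I_Y\subseteq\mathcal{O}_X$, $I(\mathcal{F},Y)$ denotes the largest ideal $I$ of $\mathcal{O}_X$ such that $I\subseteq I_Y$ and $\partial(I)\subseteq I$ for all $\partial\in\mathcal{F}$ (it exists and is unique, being the sum of all such ideals). The minimal invariant variety $V(\mathcal{F},Y)$ is the zero set of $I(\mathcal{F},Y)$ in $X$; for a point $x$, $V(\mathcal{F},x):=V(\mathcal{F},\{x\})$. Let $\mathcal{M}$ be the $\sigma$-algebra on $X$ generated by the Zariski-open sets; a function $f:X\to\mathbb{N}$ is measurable for the Zariski topology if $f^{-1}(k)\in\mathcal{M}$ for all $k$. A property holds for every very generic point of $X$ if it holds at every point of some countable intersection of nonempty Zariski-open subsets of $X$. *)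

(* Defs.v *)
(* The complex numbers are modelled as  R[i]  (real_closed's
   [complex]) over an arbitrary  R : realType  (a model of the real line).
   Affine varieties are embedded: X is a Zariski-closed irreducible subset of
   C^n, points are functions 'I_n -> C.  Regular functions on X are functions
   X -> C that are restrictions of polynomial functions. *)
From mathcomp Require Import all_boot all_algebra.
From mathcomp Require Import reals complex.
From Stdlib Require Import ClassicalEpsilon.
Set Implicit Arguments. Unset Strict Implicit. Unset Printing Implicit Defensive.
Import GRing.Theory.
Local Open Scope ring_scope.

Section AffineGeometry.
Variables (C : fieldType) (n : nat).

Definition point := 'I_n -> C.

Inductive polyfun : (point -> C) -> Prop :=
| polyfun_const (c : C) : polyfun (fun _ => c)
| polyfun_coord (i : 'I_n) : polyfun (fun x => x i)
| polyfun_add f g : polyfun f -> polyfun g -> polyfun (fun x => f x + g x)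
| polyfun_mul f g : polyfun f -> polyfun g -> polyfun (fun x => f x * g x).

Definition zclosed (Y : point -> Prop) : Prop :=
  exists S : (point -> C) -> Prop,
    (forall f, S f -> polyfun f) /\
    (forall x, Y x <-> (forall f, S f -> f x = 0)).

Definition zirreducible (Y : point -> Prop) : Prop :=
  (exists x, Y x) /\
  forall Y1 Y2, zclosed Y1 -> zclosed Y2 ->
    (forall x, Y x -> Y1 x \/ Y2 x) ->
    (forall x, Y x -> Y1 x) \/ (forall x, Y x -> Y2 x).

Definition affine_variety (X : point -> Prop) : Prop :=
  zclosed X /\ zirreducible X.

Definition zopen_in (X U : point -> Prop) : Prop :=
  exists Y, zclosed Y /\ forall x, U x <-> (X x /\ ~ Y x).

Definition zchain (V : point -> Prop) (Z : nat -> point -> Prop) (k : nat) :=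
  (forall i, (i <= k)%N ->
     zclosed (Z i) /\ zirreducible (Z i) /\ (forall x, Z i x -> V x)) /\
  (forall i, (i < k)%N ->
     (forall x, Z i x -> Z i.+1 x) /\ exists x, Z i.+1 x /\ ~ Z i x).

Definition is_zdim (V : point -> Prop) (k : nat) : Prop :=
  (exists Z, zchain V Z k) /\ ~ (exists Z, zchain V Z k.+1).

Definition zdim (V : point -> Prop) : nat :=
  epsilon (inhabits 0%N) (is_zdim V).

Section OnX.
Variable X : point -> Prop.

Definition Xpoint := {x : point | X x}.

Definition regular (f : Xpoint -> C) : Prop :=
  exists p, polyfun p /\ forall x : Xpoint, f x = p (proj1_sig x).

(* C-derivations of O_X (algebraic vector fields on X); only their action on
   regular functions is relevant *)
Definition derivation (d : (Xpoint -> C) -> (Xpoint -> C)) : Prop :=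
  (forall f, regular f -> regular (d f)) /\
  (forall f g, regular f -> regular g ->
     d (fun x => f x + g x) = (fun x => d f x + d g x)) /\
  (forall (c : C) f, regular f -> d (fun x => c * f x) = (fun x => c * d f x)) /\
  (forall f g, regular f -> regular g ->
     d (fun x => f x * g x) = (fun x => f x * d g x + g x * d f x)).

Definition foliation (F : ((Xpoint -> C) -> (Xpoint -> C)) -> Prop) : Prop :=
  (forall d, F d -> derivation d) /\
  (forall d1 d2, F d1 -> F d2 -> exists d3, F d3 /\
     forall f, regular f -> d3 f = (fun x => d1 (d2 f) x - d2 (d1 f) x)).

Definition ideal (I : (Xpoint -> C) -> Prop) : Prop :=
  (forall f, I f -> regular f) /\
  I (fun _ => 0) /\
  (forall f g, I f -> I g -> I (fun x => f x + g x)) /\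
  (forall f g, regular g -> I f -> I (fun x => g x * f x)).

Definition vanishing_ideal (Y : point -> Prop) (f : Xpoint -> C) : Prop :=
  regular f /\ forall x : Xpoint, Y (proj1_sig x) -> f x = 0.

Definition invariant (F : ((Xpoint -> C) -> (Xpoint -> C)) -> Prop)
    (I : (Xpoint -> C) -> Prop) : Prop :=
  forall d f, F d -> I f -> I (d f).

(* I(F,Y): the largest F-invariant ideal contained in I_Y (= union, which is
   also the sum, of all such ideals) *)
Definition inv_ideal F (Y : point -> Prop) (f : Xpoint -> C) : Prop :=
  exists I, ideal I /\ (forall g, I g -> vanishing_ideal Y g) /\
            invariant F I /\ I f.

Definition min_inv_variety F (Y : point -> Prop) (x : point) : Prop :=
  exists Hx : X x, forall f, inv_ideal F Y f -> f (exist _ x Hx) = 0.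

Definition nF F (x : point) : nat := zdim (min_inv_variety F (fun y => y = x)).

Definition sigma_algebra_on (M : (point -> Prop) -> Prop) : Prop :=
  (forall A, M A -> forall x, A x -> X x) /\
  M X /\
  (forall A, M A -> M (fun x => X x /\ ~ A x)) /\
  (forall A : nat -> point -> Prop, (forall k, M (A k)) -> M (fun x => exists k, A k x)).

Definition zariski_measurable_set (A : point -> Prop) : Prop :=
  forall M, sigma_algebra_on M -> (forall U, zopen_in X U -> M U) -> M A.

Definition zariski_measurable (g : point -> nat) : Prop :=
  forall k : nat, zariski_measurable_set (fun x => X x /\ g x = k).

Definition very_generic (P : point -> Prop) : Prop :=
  exists U : nat -> point -> Prop,
    (forall k, zopen_in X (U k) /\ exists x, U k x) /\
    forall x, X x -> (forall k, U k x) -> P x.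

End OnX.
End AffineGeometry.

(* Main.v *)
(* Algebraic independence of coordinates replaces Hilbert polynomials and
   Noether normalisation.  The ideal I(F,x) consists of the functions f such
   that D f (x) = 0 for every composite D of derivations in F.  Hence, for a set
   S of coordinates and a degree bound k, the points x at which no nonzero
   bounded polynomial in S belongs to I(F,x) form an open set O(S,k): over a
   basis b_j of these polynomials, it is where some determinant of values
   D_i b_j does not vanish.  Since dim V(F,x) is the largest cardinality of
   a set S that is algebraically independent modulo I(F,x), dim V(F,x) >= q
   means that x lies in the intersection over k of O(S,k) for some S of
   cardinality q; this gives measurability, and p is the largest q for which
   some S of cardinality q has all O(S,k) nonempty.

   That the Krull dimension of the zero set of an ideal J is the largest
   cardinality of a set S independent modulo J is proved with the
   uncountability of C: it makes S minus s independent modulo J + (x_s - c)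
   for some constant c, which yields both the Nullstellensatz and long chains.
   Conversely, each strict inclusion in a chain of irreducible closed sets
   allows one more independent coordinate. *)
From mathcomp Require Import boolp classical_sets reals complex.
From mathcomp Require Import all_boot all_order perm all_algebra.
From mathcomp Require Import ring lra.
From Stdlib Require Import ClassicalEpsilon.
Require Import Defs.
Set Implicit Arguments. Unset Strict Implicit. Unset Printing Implicit Defensive.
Import Order.TTheory GRing.Theory Num.Theory.
Local Open Scope ring_scope.

(** * Uncountability of the complex numbers *)

(** A pigeonhole form of uncountability: required of every [phi], it excludes injections of [T] into
    [nat]. Duplicate-free lists of every length express that the fibre is infinite. *)
Definition infinite_fiber (T : eqType) (phi : T -> nat) :=
  exists N, forall k, exists s : seq T,
    [/\ uniq s, size s = k & forall c, c \in s -> phi c = N].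

Lemma finite_fiber_cover (T : eqType) (phi : T -> nat) :
  ~ infinite_fiber phi ->
  exists s : nat -> seq T, forall c, c \in s (phi c).
Proof.
move=> nfib; suff /choice[s sP] : forall N, exists s : seq T, forall c, phi c = N -> c \in s.
  by exists s => c; apply: sP.
move=> N; apply: contrapT => nos; apply: nfib; exists N.
elim=> [|k [s [us sk sN]]]; first by exists [::].
have /existsNP[c /not_implyP[cN /negP cs]] : ~ (forall c, phi c = N -> c \in s).
  by move=> h; apply: nos; exists s.
exists (c :: s); split; rewrite /= ?cs ?us ?sk // => d.
by rewrite in_cons => /predU1P[->|/sN].
Qed.

Lemma subinterval_avoiding (R : realFieldType) (s : seq R) (a b : R) : a < b ->
  exists2 I : R * R, a <= I.1 /\ I.2 <= b &
    I.1 < I.2 /\ forall c, c \in s -> ~~ (I.1 <= c <= I.2).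
Proof.
elim: s a b => [|e s IH] a b ab; first by exists (a, b).
have [I [aI Ib] [II Is]] : exists2 I : R * R, a <= I.1 /\ I.2 <= b &
    I.1 < I.2 /\ ~~ (I.1 <= e <= I.2).
  have [em|me] := ltP e ((a + b) / 2).
    exists ((a + b) / 2, b) => /=; first by split; lra.
    by split; [lra | rewrite leNgt em].
  (* The left quarter is taken, since the right endpoint of the left half may be [e]. *)
  exists (a, (a + (a + b) / 2) / 2) => /=; first by split; lra.
  by split; [lra | rewrite negb_and -!ltNge; apply/orP; right; lra].
have [K [IK KI] [KK Ks]] := IH _ _ II.
exists K; first by split; [exact: le_trans IK | exact: le_trans Ib].
split=> // c; rewrite in_cons => /predU1P[->|/Ks//].
apply: contra Is => /andP[h1 h2].
by rewrite (le_trans IK h1) (le_trans h2 KI).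
Qed.

(** Cantor's nested intervals: if all fibres were finite, the interval of index [k+1] could avoid
    the fibre over [k], and a point common to all intervals would avoid its own fibre. *)
Lemma real_infinite_fiber (R : realType) (phi : R -> nat) : infinite_fiber phi.
Proof.
apply: contrapT => /finite_fiber_cover[s sP].
have /choice[f fP] : forall t : nat * (R * R), exists K : R * R, t.2.1 < t.2.2 ->
    (t.2.1 <= K.1 /\ K.2 <= t.2.2) /\
    (K.1 < K.2 /\ forall c, c \in s t.1 -> ~~ (K.1 <= c <= K.2)).
  move=> [k [a b]] /=; have [ab|/negP ab] := boolP (a < b); last by exists (a, b).
  by have [K ? ?] := subinterval_avoiding (s k) ab; exists K.
pose I := fix I k := if k is k'.+1 then f (k', I k') else (0, 1) : R * R.
have Ilt k : (I k).1 < (I k).2.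
  by elim: k => [|k IH] /=; [rewrite /= ltr01 | have [_ []] := fP (k, I k) IH].
have Istep k : (I k).1 <= (I k.+1).1 /\ (I k.+1).2 <= (I k).2.
  by have [] := fP (k, I k) (Ilt k).
have Imono k d : (I k).1 <= (I (k + d)%N).1 /\ (I (k + d)%N).2 <= (I k).2.
  elim: d => [|d [h1 h2]]; first by rewrite addn0.
  have [h3 h4] := Istep (k + d)%N; rewrite addnS.
  by split; [exact: le_trans h3 | exact: le_trans h2].
have Icross k l : (I k).1 <= (I l).2.
  have [kl|/ltnW lk] := leqP k l.
    have [h1 _] := Imono k (l - k)%N; rewrite subnKC // in h1.
    exact: le_trans h1 (ltW (Ilt _)).
  have [_ h1] := Imono l (k - l)%N; rewrite subnKC // in h1.
  exact: le_trans (ltW (Ilt _)) h1.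
pose E : classical_sets.set R := fun x => exists k, x = (I k).1.
have supE : has_sup E.
  split; first by exists (I 0%N).1, 0%N.
  by exists (I 0%N).2 => x [k ->].
pose x := sup E.
have xI k : (I k).1 <= x <= (I k).2.
  apply/andP; split; first by apply: sup_upper_bound => //; exists k.
  apply: ge_sup; first by case: supE.
  by move=> y [j ->].
have [_ [_ h]] := fP (phi x, I (phi x)) (Ilt _).
by have := h _ (sP x); rewrite /= (xI (phi x).+1).
Qed.

Lemma complex_infinite_fiber (R : realType) (phi : R[i] -> nat) :
  infinite_fiber phi.
Proof.
have [N h] := real_infinite_fiber (fun x : R => phi (real_complex R x)).
exists N => k; have [s [us sk sN]] := h k.
exists (map (real_complex R) s); split; rewrite ?size_map //.
  by rewrite map_inj_uniq // => x y [].
by move=> c /mapP[x xs ->]; apply: sN.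
Qed.

(** * Polynomial functions *)

Section Polyfun.
Variables (C : fieldType) (n : nat).
Implicit Types (f g h : point C n -> C) (P Q : point C n -> {poly C}).
Implicit Types (S : {set 'I_n}) (x y : point C n).

Lemma polyfun_sum (I : Type) (r : seq I) (p : pred I) (F : I -> point C n -> C) :
  (forall i, polyfun (F i)) -> polyfun (fun x => \sum_(i <- r | p i) F i x).
Proof.
move=> hF; elim: r => [|i r IH].
  rewrite (_ : (fun x => _) = fun _ => 0); first exact: polyfun_const.
  by apply/funext => x; rewrite big_nil.
have [pi|npi] := boolP (p i).
  rewrite (_ : (fun x => _) = fun x => F i x + \sum_(i <- r | p i) F i x).
    exact: polyfun_add.
  by apply/funext => x; rewrite big_cons pi.
congr polyfun: IH; apply/funext => x; by rewrite big_cons (negPf npi).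
Qed.

Lemma polyfun_prod (I : Type) (r : seq I) (p : pred I) (F : I -> point C n -> C) :
  (forall i, polyfun (F i)) -> polyfun (fun x => \prod_(i <- r | p i) F i x).
Proof.
move=> hF; elim: r => [|i r IH].
  rewrite (_ : (fun x => _) = fun _ => 1); first exact: polyfun_const.
  by apply/funext => x; rewrite big_nil.
have [pi|npi] := boolP (p i).
  rewrite (_ : (fun x => _) = fun x => F i x * \prod_(i <- r | p i) F i x).
    exact: polyfun_mul.
  by apply/funext => x; rewrite big_cons pi.
congr polyfun: IH; apply/funext => x; by rewrite big_cons (negPf npi).
Qed.

Lemma polyfun_exp f m : polyfun f -> polyfun (fun x => f x ^+ m).
Proof.
move=> hf; rewrite (_ : (fun x => _) = fun x => \prod_(i < m) f x).
  exact: polyfun_prod.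
by apply/funext => x; rewrite prodr_const card_ord.
Qed.

Lemma polyfun_scale c f : polyfun f -> polyfun (fun x => c * f x).
Proof. by move=> hf; apply: polyfun_mul => //; exact: polyfun_const. Qed.

Lemma polyfun_sub f g : polyfun f -> polyfun g -> polyfun (fun x => f x - g x).
Proof.
move=> hf hg; rewrite (_ : (fun x => _) = fun x => f x + -1 * g x).
  by apply: polyfun_add => //; exact: polyfun_scale.
by apply/funext => x; rewrite mulN1r.
Qed.

(** Models polynomials in one variable over the ring of polynomial functions of [x]; the degree is
    bounded uniformly in [x]. *)
Definition polyfam P :=
  (forall k, polyfun (fun x => (P x)`_k)) /\ exists d, forall x, (size (P x) <= d)%N.

Lemma polyfam_polyC f : polyfun f -> polyfam (fun x => (f x)%:P).
Proof.
move=> hf; split; last by exists 1%N => x; exact: size_polyC_leq1.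
case=> [|k]; first by congr polyfun: hf; apply/funext => x; rewrite coefC.
rewrite (_ : (fun x => _) = fun _ => 0); first exact: polyfun_const.
by apply/funext => x; rewrite coefC.
Qed.

Lemma polyfam_const (p : {poly C}) : polyfam (fun _ => p).
Proof.
by split=> [k|]; [exact: (polyfun_const _ p`_k) | exists (size p)].
Qed.

Lemma polyfam_add P Q : polyfam P -> polyfam Q -> polyfam (fun x => P x + Q x).
Proof.
move=> [hP [d hd]] [hQ [e he]]; split=> [k|].
  have := polyfun_add (hP k) (hQ k).
  by congr polyfun; apply/funext => x; rewrite coefD.
exists (maxn d e) => x; apply: (leq_trans (size_polyD _ _)).
by rewrite geq_max !leq_max hd he orbT.
Qed.

Lemma polyfam_mul P Q : polyfam P -> polyfam Q -> polyfam (fun x => P x * Q x).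
Proof.
move=> [hP [d hd]] [hQ [e he]]; split=> [k|].
  rewrite (_ : (fun x => _) = fun x => \sum_(i < k.+1) (P x)`_i * (Q x)`_(k - i)).
    by apply: polyfun_sum => i; apply: polyfun_mul.
  by apply/funext => x; rewrite coefM.
exists (d + e)%N => x; apply: (leq_trans (size_polyMleq _ _)).
by apply: (leq_trans (leq_pred _)); rewrite leq_add.
Qed.

Lemma polyfam_sum (I : Type) (r : seq I) (F : I -> point C n -> {poly C}) :
  (forall i, polyfam (F i)) -> polyfam (fun x => \sum_(i <- r) F i x).
Proof.
move=> hF; elim: r => [|i r IH].
  rewrite (_ : (fun x => _) = fun _ => 0); first exact: polyfam_const.
  by apply/funext => x; rewrite big_nil.
rewrite (_ : (fun x => _) = fun x => F i x + \sum_(i <- r) F i x).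
  exact: polyfam_add.
by apply/funext => x; rewrite big_cons.
Qed.

Lemma polyfam_prod (I : Type) (r : seq I) (F : I -> point C n -> {poly C}) :
  (forall i, polyfam (F i)) -> polyfam (fun x => \prod_(i <- r) F i x).
Proof.
move=> hF; elim: r => [|i r IH].
  rewrite (_ : (fun x => _) = fun _ => 1); first exact: polyfam_const.
  by apply/funext => x; rewrite big_nil.
rewrite (_ : (fun x => _) = fun x => F i x * \prod_(i <- r) F i x).
  exact: polyfam_mul.
by apply/funext => x; rewrite big_cons.
Qed.

Lemma polyfam_char_poly m (H : point C n -> 'M[C]_m) :
  (forall i j, polyfun (fun x => H x i j)) -> polyfam (fun x => char_poly (H x)).
Proof.
move=> hH; rewrite /char_poly /determinant; apply: polyfam_sum => s.
apply: polyfam_mul; first exact: polyfam_const.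
apply: polyfam_prod => i.
rewrite (_ : (fun x => _) =
  fun x => (if i == s i then 'X else 0) + (-1 * H x i (s i))%:P).
  by apply: polyfam_add; [exact: polyfam_const | apply/polyfam_polyC/polyfun_scale].
by apply/funext => x; rewrite !mxE mulrb mulN1r polyCN.
Qed.

Lemma polyfun_subst g (q : 'I_n -> point C n -> {poly C}) :
  polyfun g -> (forall i, polyfam (q i)) ->
  exists2 P, polyfam P & forall x z, g (fun i => (q i x).[z]) = (P x).[z].
Proof.
move=> hg hq; elim: hg => [c|i|f1 f2 _ [P1 h1 e1] _ [P2 h2 e2]
                           |f1 f2 _ [P1 h1 e1] _ [P2 h2 e2]].
- by exists (fun _ => c%:P); [exact: polyfam_const | move=> x z; rewrite hornerC].
- by exists (q i).
- exists (fun x => P1 x + P2 x); first exact: polyfam_add.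
  by move=> x z; rewrite hornerD e1 e2.
- exists (fun x => P1 x * P2 x); first exact: polyfam_mul.
  by move=> x z; rewrite hornerM e1 e2.
Qed.

(** * Monomials and the finite-dimensional spaces they span *)

Definition monomial (w : seq 'I_n) x := \prod_(i <- w) x i.

Definition monomial_nat (k : nat) : point C n -> C :=
  if unpickle k is Some w then monomial w else fun _ => 0.

(** Stands for a degree bound: as [N] grows, these finite-dimensional spaces exhaust the polynomial
    functions. *)
Definition monomial_span N f :=
  exists a : nat -> C, forall x, f x = \sum_(k < N) a k * monomial_nat k x.

Lemma monomial_span_mono N M f : (N <= M)%N -> monomial_span N f -> monomial_span M f.
Proof.
move=> NM [a fa]; exists (fun k => if (k < N)%N then a k else 0) => x.
rewrite fa (big_ord_widen M (fun k => a k * monomial_nat k x)) // big_mkcond.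
by apply: eq_bigr => k _; case: ifP; rewrite ?mul0r.
Qed.

Lemma monomial_span_add N f g :
  monomial_span N f -> monomial_span N g -> monomial_span N (fun x => f x + g x).
Proof.
move=> [a fa] [b gb]; exists (fun k => a k + b k) => x.
by rewrite fa gb -big_split; apply: eq_bigr => k _; rewrite mulrDl.
Qed.

Lemma polyfun_monomial_span f : polyfun f -> exists N, monomial_span N f.
Proof.
move=> hf.
have [l fl] : exists l : seq (C * seq 'I_n), forall x,
    f x = \sum_(t <- l) t.1 * monomial t.2 x.
  elim: hf => [c|i|f1 f2 _ [l1 h1] _ [l2 h2]|f1 f2 _ [l1 h1] _ [l2 h2]].
  - by exists [:: (c, [::])] => x; rewrite big_seq1 /monomial big_nil mulr1.
  - by exists [:: (1, [:: i])] => x; rewrite big_seq1 /monomial big_seq1 mul1r.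
  - by exists (l1 ++ l2) => x; rewrite big_cat h1 h2.
  - exists [seq (t.1 * u.1, t.2 ++ u.2) | t <- l1, u <- l2] => x.
    rewrite big_allpairs_dep h1 h2 big_distrl /=; apply: eq_bigr => t _.
    rewrite big_distrr; apply: eq_bigr => u _ /=.
    by rewrite /monomial big_cat /=; ring.
elim: l f fl {hf} => [|[c w] l IH] f fl.
  by exists 0%N, (fun=> 0) => x; rewrite fl big_nil big_ord0.
have [N hN] := IH _ (fun=> erefl).
exists (maxn N (pickle w).+1).
rewrite (_ : f = fun x => c * monomial w x + \sum_(t <- l) t.1 * monomial t.2 x);
  last by apply/funext => x; rewrite fl big_cons.
apply: monomial_span_add; last by apply: monomial_span_mono hN; rewrite leq_maxl.
apply: (@monomial_span_mono (pickle w).+1); first by rewrite leq_maxr.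
exists (fun k => if k == pickle w then c else 0) => x.
rewrite big_ord_recr big1 /= ?eqxx => [|k _]; first by rewrite add0r /monomial_nat pickleK.
by rewrite (ltn_eqF (ltn_ord k)) mul0r.
Qed.

(** * Polynomial functions of a subset of the coordinates *)

Definition agree S x y := forall i, i \in S -> x i = y i.

Definition polyS S g := polyfun g /\ forall x y, agree S x y -> g x = g y.

Lemma polyS_const S c : polyS S (fun=> c).
Proof. by split=> //; exact: polyfun_const. Qed.

Lemma polyS_coord S i : i \in S -> polyS S (fun x => x i).
Proof. by move=> iS; split=> [|x y]; [exact: polyfun_coord | apply]. Qed.

Lemma polyS_add S f g : polyS S f -> polyS S g -> polyS S (fun x => f x + g x).
Proof.
move=> [hf df] [hg dg]; split; first exact: polyfun_add.
by move=> x y xy; rewrite (df _ _ xy) (dg _ _ xy).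
Qed.

Lemma polyS_mul S f g : polyS S f -> polyS S g -> polyS S (fun x => f x * g x).
Proof.
move=> [hf df] [hg dg]; split; first exact: polyfun_mul.
by move=> x y xy; rewrite (df _ _ xy) (dg _ _ xy).
Qed.

Lemma polyS_sub S (T : {set 'I_n}) g : S \subset T -> polyS S g -> polyS T g.
Proof.
move=> /subsetP ST [hg dg]; split=> // x y xy.
by apply: dg => i /ST; apply: xy.
Qed.

Lemma polyS_sum S (I : Type) (r : seq I) (p : pred I) (F : I -> point C n -> C) :
  (forall i, polyS S (F i)) -> polyS S (fun x => \sum_(i <- r | p i) F i x).
Proof.
move=> hF; split; first by apply: polyfun_sum => i; case: (hF i).
by move=> x y xy; apply: eq_bigr => i _; case: (hF i) => _; apply.
Qed.

Lemma polyS_prod S (I : Type) (r : seq I) (p : pred I) (F : I -> point C n -> C) :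
  (forall i, polyS S (F i)) -> polyS S (fun x => \prod_(i <- r | p i) F i x).
Proof.
move=> hF; split; first by apply: polyfun_prod => i; case: (hF i).
by move=> x y xy; apply: eq_bigr => i _; case: (hF i) => _; apply.
Qed.

Definition upd x s z : point C n := fun i => if i == s then z else x i.

Lemma polyfun_upd g s : polyfun g ->
  exists2 P, polyfam P & forall x z, g (upd x s z) = (P x).[z].
Proof.
move=> hg; have [|P hP eP] := @polyfun_subst g
    (fun i x => if i == s then 'X else (x i)%:P) hg.
  move=> i; case: eqP => _; first exact: polyfam_const.
  exact/polyfam_polyC/polyfun_coord.
exists P => // x z; rewrite -eP; congr g; apply/funext => i.
by rewrite /upd; case: eqP; rewrite ?hornerX ?hornerC.
Qed.

Section Infinite.
Hypothesis Cinf : forall k, exists s : seq C, uniq s /\ size s = k.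

Lemma poly_eq_ext (p q : {poly C}) : (forall z, p.[z] = q.[z]) -> p = q.
Proof.
move=> pq; apply/eqP; rewrite -subr_eq0; apply/eqP.
have [s [us ss]] := Cinf (size (p - q)).
apply: (roots_geq_poly_eq0 (rs := s)); rewrite ?ss //.
by apply/allP => z _; rewrite /root !hornerE pq subrr.
Qed.

(** On the line through the two points, [f] and [g] become nonzero polynomials in one variable;
    their product is nonzero, hence has a nonzero value over an infinite field. *)
Lemma polyfun_mul_neq0 f g : polyfun f -> polyfun g ->
  (exists x, f x <> 0) -> (exists x, g x <> 0) -> exists x, f x * g x <> 0.
Proof.
move=> hf hg [x fx] [y gy].
pose q i (_ : point C n) := (x i)%:P + (y i - x i) *: 'X.
have hq i : polyfam (q i) by exact: polyfam_const.
have [P _ eP] := polyfun_subst hf hq; have [Q _ eQ] := polyfun_subst hg hq.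
have qx : (fun i => (q i x).[0]) = x.
  by apply/funext => i; rewrite /q !hornerE ?mulr0 ?addr0.
have qy : (fun i => (q i x).[1]) = y.
  by apply/funext => i; rewrite /q !hornerE /= addrAC subrr add0r.
apply: contrapT => /forallNP nfg.
have /eqP : P x * Q x = 0.
  apply: poly_eq_ext => z; rewrite hornerM -eP -eQ horner0.
  exact: contrapT (nfg _).
rewrite mulf_eq0 => /orP[] /eqP h.
  by apply: fx; rewrite -qx eP h horner0.
by apply: gy; rewrite -qy eQ h horner0.
Qed.

(** Points that agree on [S] give polynomials with the same values, hence, the field being infinite,
    with the same coefficients. *)
Lemma polyS_upd S t g : polyS (t |: S) g -> t \notin S ->
  exists P, [/\ polyfam P, forall x y, agree S x y -> P x = P y,
    forall k, polyS S (fun x => (P x)`_k) & forall x z, g (upd x t z) = (P x).[z]].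
Proof.
move=> [hg dg] tS; have [P hP eP] := polyfun_upd t hg; exists P.
have dP x y : agree S x y -> P x = P y.
  move=> xy; apply: poly_eq_ext => z; rewrite -!eP; apply: dg => i.
  by rewrite /upd !inE; case: eqP => //= _ /xy.
split=> // k; split; first by case: hP.
by move=> x y /dP ->.
Qed.

End Infinite.
End Polyfun.

(** * Ideals and algebraic independence of coordinates *)

Section PolyIdeal.
Variables (C : fieldType) (n : nat).
Implicit Types (f g h a : point C n -> C) (J : (point C n -> C) -> Prop).
Implicit Types (S : {set 'I_n}) (x y : point C n).

Definition poly_ideal J :=
  [/\ forall f, J f -> polyfun f, J (fun=> 0),
      forall f g, J f -> J g -> J (fun x => f x + g x) &
      forall f g, polyfun g -> J f -> J (fun x => g x * f x)].

Definition zeros J x := forall g, J g -> g x = 0.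

Definition adjoin J a h :=
  exists q r, [/\ J q, polyfun r & forall x, h x = q x + r x * a x].

Lemma adjoin_incl J a f : J f -> adjoin J a f.
Proof.
move=> Jf; exists f, (fun=> 0); split=> //; first exact: polyfun_const.
by move=> x; rewrite mul0r addr0.
Qed.

Lemma adjoin_gen J a : poly_ideal J -> adjoin J a a.
Proof.
case=> _ J0 _ _; exists (fun=> 0), (fun=> 1); split=> //; first exact: polyfun_const.
by move=> x; rewrite mul1r add0r.
Qed.

Lemma adjoin_ideal J a : poly_ideal J -> polyfun a -> poly_ideal (adjoin J a).
Proof.
move=> [Jp J0 JD JM] ha; split.
- move=> f [q [r [/Jp hq hr e]]].
  by rewrite (funext e); apply: polyfun_add => //; apply: polyfun_mul.
- exact: adjoin_incl.
- move=> f g [q [r [hq hr e]]] [q' [r' [hq' hr' e']]].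
  exists (fun x => q x + q' x), (fun x => r x + r' x); split; first exact: JD.
    exact: polyfun_add.
  by move=> x; rewrite e e'; ring.
- move=> f g hg [q [r [hq hr e]]].
  exists (fun x => g x * q x), (fun x => g x * r x); split; first exact: JM.
    exact: polyfun_mul.
  by move=> x; rewrite e; ring.
Qed.

Lemma ideal_sum J (I : finType) (F : I -> point C n -> C) : poly_ideal J ->
  (forall i, J (F i)) -> J (fun x => \sum_i F i x).
Proof.
move=> [_ J0 JD _] hF; elim: (index_enum I) => [|i r IH].
  by congr J: J0; apply/funext => x; rewrite big_nil.
by congr J: (JD _ _ (hF i) IH); apply/funext => x; rewrite big_cons.
Qed.

(* For [f = 1]: the coordinates in [S] are algebraically independent modulo
   [J]; in general, modulo the saturation of [J] by [f]. *)
Definition indep S f J :=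
  forall g m, polyS S g -> (exists x, g x <> 0) -> ~ J (fun x => g x * f x ^+ m).

Definition one : point C n -> C := fun=> 1.

Lemma indep1P S J :
  indep S one J <-> forall g, polyS S g -> (exists x, g x <> 0) -> ~ J g.
Proof.
have e g m : (fun x => g x * one x ^+ m) = g by apply/funext => x; rewrite expr1n mulr1.
split=> h g; first by move=> hg gx; have := h g 0%N hg gx; rewrite e.
by move=> m hg gx; rewrite e; exact: h.
Qed.

Lemma indep0P f J : poly_ideal J ->
  indep finset.set0 f J <-> forall m, ~ J (fun x => f x ^+ m).
Proof.
move=> [_ _ _ JM]; split=> [h m Jm|h g m [hg dg] [x gx] Jm].
  apply: (h (fun=> 1) m); first exact: polyS_const.
    by exists (fun=> 0); exact/eqP/oner_neq0.
  by congr J: Jm; apply/funext => x; rewrite mul1r.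
apply: (h m); congr J: (JM _ _ (polyfun_const n (g x)^-1) Jm).
apply/funext => y; have -> : g y = g x by apply: dg => i; rewrite inE.
by rewrite mulrA mulVf ?mul1r //; exact/eqP.
Qed.

Lemma monomial_span_dependent N (r : 'I_N.+1 -> point C n -> C) :
  (forall i, monomial_span N (r i)) ->
  exists2 l : 'I_N.+1 -> C, exists i, l i <> 0 & forall x, \sum_i l i * r i x = 0.
Proof.
move=> /choice[a ra]; pose M := \matrix_(i < N.+1, j < N) a i j.
have /rowV0Pn[v /sub_kermxP vM v0] : kermx M != 0.
  by rewrite kermx_eq0 -row_leq_rank -ltnNge ltnS rank_leq_col.
exists (fun i => v 0 i).
  apply: contrapT => /forallNP h; move: v0; apply/negP; rewrite negbK.
  by apply/eqP/rowP => i; rewrite mxE; exact: contrapT (h i).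
move=> x; under eq_bigr => i _ do rewrite ra big_distrr.
rewrite exchange_big big1 //= => k _.
under eq_bigr => i _ do rewrite mulrA.
rewrite -big_distrl /=.
rewrite (_ : \sum_i v 0 i * a i k = 0) ?mul0r //.
have /rowP/(_ k) := vM; rewrite !mxE => e; rewrite -[RHS]e.
by apply: eq_bigr => i _; rewrite mxE.
Qed.

Section Uncountable.
Hypothesis Cunc : forall phi : C -> nat, infinite_fiber phi.

Lemma uncountable_infinite k : exists s : seq C, uniq s /\ size s = k.
Proof. by have [N /(_ k)[s []]] := Cunc (fun=> 0%N); exists s. Qed.
Let Cinf := uncountable_infinite.

(* If each [x_s - c] became dependent over [S :\ s], there would be relations
   [g_c f^m_c = r_c (x_s - c)] modulo [J].  For infinitely many [c] the
   exponent and the number of monomials of [r_c] are the same, so finitely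
   many [r_c] are linearly dependent; clearing the denominators [x_s - c] in
   this dependency gives a relation over [S]. *)
Lemma indep_cut S s f J : poly_ideal J -> polyfun f -> s \in S -> indep S f J ->
  exists c, indep (S :\ s) f (adjoin J (fun x => x s - c)).
Proof.
move=> hJ hf sS ind; apply: contrapT => /forallNP no.
have /choice[t tP] : forall c, exists t : (point C n -> C) * (point C n -> C) *
    (point C n -> C) * nat * nat,
    let: (g, q, r, m, N) := t in
    [/\ polyS (S :\ s) g, exists x, g x <> 0, J q, monomial_span N r &
     forall x, g x * f x ^+ m = q x + r x * (x s - c)].
  move=> c; have := no c; rewrite /indep.
  move=> /existsNP[g /existsNP[m /not_implyP[hg /not_implyP[gx /contrapT]]]].
  move=> [q [r [hq hr e]]]; have [N hN] := polyfun_monomial_span hr.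
  by exists (g, q, r, m, N).
(* Pigeonhole on the pair of exponent and monomial bound. One element of the fibre serves to read
   off the pair [(M, N)]; then [N+1] distinct constants are taken from it. *)
have [K hK] := Cunc (fun c => pickle ((t c).1.2, (t c).2)).
have [s1 [_ ss1 sK1]] := hK 1%N.
case: s1 ss1 sK1 => // c1 s1 _ sK1.
set M := (t c1).1.2; set N := (t c1).2.
have EK : K = pickle (M, N) by rewrite -(sK1 c1) ?mem_head.
have [sq [us ss sK]] := hK N.+1.
pose c (i : 'I_N.+1) := sq`_i.
have cinj i j : i != j -> c i - c j != 0.
  by move=> ij; rewrite subr_eq0 nth_uniq ?ss.
have tK i : (t (c i)).1.2 = M /\ (t (c i)).2 = N.
  have := sK (c i) (mem_nth _ _); rewrite ss ltn_ord EK => /(_ isT).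
  by move=> /(pcan_inj pickleK) [-> ->].
pose g i := (t (c i)).1.1.1.1; pose q i := (t (c i)).1.1.1.2.
pose r i := (t (c i)).1.1.2.
have tc i : [/\ polyS (S :\ s) (g i), exists x, g i x <> 0, J (q i),
    monomial_span N (r i) &
    forall x, g i x * f x ^+ M = q i x + r i x * (x s - c i)].
  have := tP (c i); have := tK i; rewrite /g /q /r.
  by case: (t (c i)) => [[[[? ?] ?] ?] ?] /= [-> ->].
have [l [i0 li0] lr] : exists2 l : 'I_N.+1 -> C, exists i, l i <> 0 &
    forall x, \sum_i l i * r i x = 0.
  by apply: monomial_span_dependent => i; case: (tc i).
pose D i x := \prod_(j < N.+1 | j != i) (x s - c j).
have hxs j : polyS S (fun x => x s - c j).
  apply: (@polyS_add _ _ _ (fun x => x s) (fun=> - c j)); first exact: polyS_coord.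
  exact: polyS_const.
have hD i : polyS S (D i) by apply: polyS_prod => j; exact: hxs.
(* Multiplying [sum l_i r_i = 0] by all the [x_s - c_j] shows that [G f^M] equals [sum l_i D_i q_i],
   which lies in [J]. *)
pose G x := \sum_i l i * (D i x * g i x).
apply: (ind G M).
- apply: polyS_sum => i; apply: polyS_mul; first exact: polyS_const.
  apply: polyS_mul => //; apply: (polyS_sub (S := S :\ s)); first exact: subD1set.
  by case: (tc i).
(* At a point with [x_s = c_i0], every term of [G] except that of index [i0] vanishes. *)
- have [[_ dg] [x gx] _ _ _] := tc i0; exists (upd x s (c i0)).
  rewrite /G (bigD1 i0) //= big1 => [|i ii0].
    have -> : g i0 (upd x s (c i0)) = g i0 x.
      by apply: dg => i; rewrite /upd !inE => /andP[/negPf ->].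
    rewrite addr0; apply/eqP; rewrite !mulf_neq0 //; try exact/eqP.
    by apply/prodf_neq0 => j ji0; rewrite /upd eqxx cinj // eq_sym.
  rewrite /D (bigD1 i0) 1?eq_sym //= {1}/upd eqxx subrr.
  by rewrite !mul0r mulr0.
rewrite (_ : (fun x => _) = fun x => \sum_i (l i * D i x) * q i x).
  apply: ideal_sum => // i; case: hJ => _ _ _; apply; last by case: (tc i).
  by apply: polyfun_scale; case: (hD i).
apply/funext => x; rewrite /G big_distrl /=; apply/eqP; rewrite -subr_eq0 -sumrB.
apply/eqP; have e0 : \sum_i l i * r i x * \prod_j (x s - c j) = 0.
  by rewrite -big_distrl /= lr mul0r.
rewrite -[RHS]e0; apply: eq_bigr => i _.
rewrite [\prod_j _](bigD1 i) //= -/(D i x).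
have [_ _ _ _ e] := tc i.
rewrite -mulrA -[D i x * _ * _]mulrA e.
ring.
Qed.

End Uncountable.
End PolyIdeal.
Arguments one {C n} _.

(** * Zero sets of ideals *)

Section ClosedField.
Variables (C : closedFieldType) (n : nat).
Hypothesis Cunc : forall phi : C -> nat, infinite_fiber phi.
Implicit Types (f g h a : point C n -> C) (J : (point C n -> C) -> Prop).
Implicit Types (S : {set 'I_n}) (x y : point C n).
Let Cinf := uncountable_infinite Cunc.

(** If [x_i] is independent modulo the saturation of [J] by [f], then [indep_cut] applies. Otherwise
    [p(x_i) f^m] lies in [J] for some nonzero [p], and some root of [p] serves as [c]: if all
    failed, the linear factors of [p] could be traded for powers of [f]. *)
Lemma saturation_coord J f i : poly_ideal J -> polyfun f ->
  (forall m, ~ J (fun x => f x ^+ m)) ->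
  exists c, forall m, ~ adjoin J (fun x => x i - c) (fun x => f x ^+ m).
Proof.
move=> hJ hf nJ; have [_ _ JD JM] := hJ.
have hxi c : polyfun (fun x => x i - c).
  by apply: polyfun_sub; [exact: polyfun_coord | exact: polyfun_const].
have [ind|] := EM (indep [set i]%SET f J).
  have [c hc] := indep_cut Cunc hJ hf (set11 i) ind; exists c.
  by apply/indep0P; [exact: adjoin_ideal | rewrite -(setDv [set i]%SET)].
move=> /existsNP[g /existsNP[m /not_implyP[hg /not_implyP[[x0 gx0] /contrapT Jg]]]].
have [P [_ dP _ eP]] : exists P, [/\ polyfam P,
    forall x y, agree finset.set0 x y -> P x = P y,
    forall k, polyS finset.set0 (fun x => (P x)`_k) & forall x z, g (upd x i z) = (P x).[z]].
  by apply: (polyS_upd Cinf); rewrite ?finset.setU0 ?inE.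
pose p := P (fun=> 0).
have gp x : g x = p.[x i].
  rewrite /p (dP _ x) => [|j]; last by rewrite inE.
  by rewrite -eP; congr g; apply/funext => j; rewrite /upd; case: eqP => [->|].
have p0 : lead_coef p != 0.
  by rewrite lead_coef_eq0; apply/eqP => p0; apply: gx0; rewrite gp p0 horner0.
have [r pr] := closed_field_poly_normal p.
apply: contrapT => /forallNP no.
have /choice[e he] : forall c, exists m, adjoin J (fun x => x i - c) (fun x => f x ^+ m).
  by move=> c; apply: contrapT => /forallNP; apply: no.
(* Each linear factor is traded for a power of [f] by means of [f^(e z) = q + rho (x_i - z)] with
   [q] in [J]. *)
have split_off : forall (s : seq C) h, polyfun h ->
    J (fun x => h x * \prod_(z <- s) (x i - z)) -> exists M, J (fun x => h x * f x ^+ M).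
  elim=> [|z s IH] h hh Jh.
    by exists 0%N; congr J: Jh; apply/funext => x; rewrite big_nil.
  have [|M JM1] := IH (fun x => h x * (x i - z)) (polyfun_mul hh (hxi z)).
    by congr J: Jh; apply/funext => x; rewrite big_cons mulrA.
  have [q [rho [Jq hrho eq]]] := he z; exists (M + e z)%N.
  have := JD _ _ (JM _ _ (polyfun_mul hh (polyfun_exp M hf)) Jq) (JM _ _ hrho JM1).
  congr J; apply/funext => x; rewrite exprD eq; ring.
have [||M JM1] := split_off r (fun x => lead_coef p * f x ^+ m).
- exact/polyfun_scale/polyfun_exp.
- congr J: Jg; apply/funext => x; rewrite gp [in p.[_]]pr hornerZ horner_prod.
  rewrite mulrAC; congr (_ * _ * _); apply: eq_bigr => z _.
  by rewrite !hornerE.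
apply: (nJ (m + M)%N); congr J: (JM _ _ (polyfun_const n (lead_coef p)^-1) JM1).
by apply/funext => x; rewrite exprD -[X in _ * X]mulrA mulKf.
Qed.

(** Coordinates are fixed one at a time while all powers of [f] stay outside the ideal. In the end
    each [g] is congruent to the constant [g(c)]; if [g(c)] were nonzero for some [g] in [J], or if
    [f(c)] were zero, a power of [f] would lie in the ideal. *)
Lemma nullstellensatz J f : poly_ideal J -> polyfun f ->
  (forall m, ~ J (fun x => f x ^+ m)) -> exists2 x, zeros J x & f x <> 0.
Proof.
move=> hJ hf nJ.
have : forall k, (k <= n)%N -> exists J', [/\ poly_ideal J', forall g, J g -> J' g,
    forall m, ~ J' (fun x => f x ^+ m) &
    forall i : 'I_n, (i < k)%N -> exists c, J' (fun x => x i - c)].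
  elim=> [|k IH] kn; first by exists J.
  have [J' [hJ' JJ' nJ' cJ']] := IH (ltnW kn).
  have [c hc] := saturation_coord (Ordinal kn) hJ' hf nJ'.
  exists (adjoin J' (fun x => x (Ordinal kn) - c)); split=> //.
  - apply: adjoin_ideal => //; apply: polyfun_sub; first exact: polyfun_coord.
    exact: polyfun_const.
  - by move=> g /JJ'; exact: adjoin_incl.
  - move=> i; rewrite ltnS leq_eqVlt => /predU1P[ik|/cJ'[d hd]].
      by exists c; rewrite (_ : i = Ordinal kn); [exact: adjoin_gen | exact: val_inj].
    by exists d; exact: adjoin_incl.
move=> /(_ n (leqnn n))[J' [[J'p J'0 J'D J'M] JJ' nJ' cJ']].
have /choice[c hc] : forall i : 'I_n, exists c, J' (fun x => x i - c).
  by move=> i; exact: cJ'.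
have modc g : polyfun g -> J' (fun x => g x - g c).
  elim=> [d|i|f1 f2 _ h1 _ h2|f1 f2 hf1 h1 _ h2].
  - by congr J': J'0; apply/funext => x; rewrite subrr.
  - exact: hc.
  - by congr J': (J'D _ _ h1 h2); apply/funext => x; ring.
  - have := J'D _ _ (J'M _ _ hf1 h2) (J'M _ _ (polyfun_const n (f2 c)) h1).
    by congr J'; apply/funext => x; ring.
exists c => [g Jg|fc].
  apply: contrapT => gc; apply: (nJ' 0%N).
  have Jgc : J' (fun x => g x + -1 * (g x - g c)).
    apply: J'D; first exact: JJ'.
    apply: J'M; first exact: polyfun_const.
    by case: hJ => /(_ _ Jg)/modc.
  congr J': (J'M _ _ (polyfun_const n (g c)^-1) Jgc); apply/funext => x.
  rewrite (_ : _ + _ = g c); last by ring.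
  by rewrite mulVf //; exact/eqP.
apply: (nJ' 1%N); congr J': (modc _ hf); apply/funext => x.
by rewrite fc subr0 expr1.
Qed.

Definition prime_ideal J :=
  forall f g, polyfun f -> polyfun g -> J (fun x => f x * g x) -> J f \/ J g.

(** An ideal maximal among those containing [J] and keeping [S] independent is prime: if it
    contained [f g] but neither factor, adjoining each factor would produce nonzero functions [u],
    [u'] of [S], and [u u'] would lie in the ideal. *)
Lemma indep_prime S J : poly_ideal J -> indep S (@one C n) J ->
  exists P, [/\ poly_ideal P, forall g, J g -> P g, indep S (@one C n) P & prime_ideal P].
Proof.
move=> hJ indJ.
pose good P := [/\ poly_ideal P, forall g, J g -> P g & indep S (@one C n) P].
(* Zorn's lemma is applied to a family containing the empty set, so that the
   empty chain has an upper bound. *)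
have [|P [PQ Pmax]] := @Zorn_bigcup (point C n -> C) (fun P => P = classical_sets.set0 \/ good P).
  move=> F FQ Ftot.
  have Fg I f : F I -> I f -> good I.
    by move=> FI If; have [I0|//] := FQ _ FI; rewrite I0 in If.
  have [[f [I FI If]]|U0] := EM (exists f, classical_sets.bigcup F id f); last first.
    left; apply/funext => f; apply/propext; split=> // Uf.
    by case: U0; exists f.
  right; have [[_ I0 _ _] JI _] := Fg _ _ FI If; split.
  - split.
    + by move=> g [K FK Kg]; have [[h _ _ _] _ _] := Fg _ _ FK Kg; exact: h.
    + by exists I.
    + move=> g h [K FK Kg] [L FL Lh].
      have [KL|LK] := Ftot _ _ FK FL.
        exists L => //; have [[_ _ LD _] _ _] := Fg _ _ FL Lh.
        by apply: LD => //; exact: KL.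
      exists K => //; have [[_ _ KD _] _ _] := Fg _ _ FK Kg.
      by apply: KD => //; exact: LK.
    + move=> g h hh [K FK Kg]; exists K => //.
      by have [[_ _ _ KM] _ _] := Fg _ _ FK Kg; exact: KM.
  - by move=> g Jg; exists I => //; exact: JI.
  - move=> g m hg gx [K FK Kg].
    by have [_ _ ind] := Fg _ _ FK Kg; exact: (ind g m).
have [hP JP indP] : good P.
  case: PQ => // P0; exfalso; apply: (Pmax J); last by right.
  rewrite P0; split=> // h; have [_ J0 _ _] := hJ; exact: (h _ J0).
have [Pp P0 PD PM] := hP.
exists P; split=> // f g hf hg Pfg; apply: contrapT => /not_orP[nf ng].
have dep a : polyfun a -> ~ P a -> exists u v q,
    [/\ polyS S u, exists x, u x <> 0, P q, polyfun v &
     forall x, u x = q x + v x * a x].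
  move=> ha na; apply: contrapT => nd; apply: (Pmax (adjoin P a)).
    split; first exact: adjoin_incl.
    by move=> h; apply/na/h/adjoin_gen.
  right; split; first exact: adjoin_ideal.
    by move=> h /JP; exact: adjoin_incl.
  apply/indep1P => u hu ux [q [v [Pq hv e]]]; apply: nd.
  by exists u, v, q.
have [u [v [q [hu ux Pq hv e]]]] := dep _ hf nf.
have [u' [v' [q' [hu' ux' Pq' hv' e']]]] := dep _ hg ng.
move/indep1P: indP => /(_ _ (polyS_mul hu hu')); apply.
  by apply: (polyfun_mul_neq0 Cinf) => //; [case: hu | case: hu'].
have h := PD _ _ (PM _ _ (polyfun_mul hv hv') Pfg)
  (PD _ _ (PM _ _ (Pp _ Pq') Pq) (PD _ _ (PM _ _ (polyfun_mul hv hf) Pq')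
          (PM _ _ (polyfun_mul hv' hg) Pq))).
congr P: h; apply/funext => x; rewrite e e'; ring.
Qed.

Lemma zeros_closed J : poly_ideal J -> zclosed (zeros J).
Proof. by case=> Jp _ _ _; exists J. Qed.

Lemma zeros_prime_nonzero P f : poly_ideal P -> prime_ideal P -> ~ P one ->
  polyfun f -> ~ P f -> exists2 x, zeros P x & f x <> 0.
Proof.
move=> hP pP P1 hf nf; apply: nullstellensatz => //.
elim=> [|m IH Pm].
  by rewrite (_ : (fun x => _) = one) //; apply/funext => x; rewrite expr0.
have [] := pP f (fun x => f x ^+ m) hf (polyfun_exp m hf) => //.
by congr P: Pm; apply/funext => x; rewrite exprS.
Qed.

(** Equations of [Y1] and [Y2] outside [P] have their product outside [P], so some zero of [P] would
    lie in neither closed set. *)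
Lemma zeros_irreducible P : poly_ideal P -> prime_ideal P -> ~ P one ->
  zirreducible (zeros P).
Proof.
move=> hP pP P1; split.
  by have [x] := zeros_prime_nonzero hP pP P1 (polyfun_const n 1) P1; exists x.
move=> Y1 Y2 [S1 [S1p Y1E]] [S2 [S2p Y2E]] cov.
apply: contrapT => /not_orP[n1 n2].
have wit Y B : (forall f : point C n -> C, B f -> polyfun f) ->
    (forall x, Y x <-> (forall f, B f -> f x = 0)) ->
    ~ (forall x, zeros P x -> Y x) -> exists2 f, B f & polyfun f /\ ~ P f.
  move=> Sp YE nY; apply: contrapT => nf; apply: nY => x Px; apply/YE => f Sf.
  by apply: Px; apply: contrapT => nPf; apply: nf; exists f => //; split; [exact: Sp|].
have [f1 Sf1 [hf1 nf1]] := wit _ _ S1p Y1E n1.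
have [f2 Sf2 [hf2 nf2]] := wit _ _ S2p Y2E n2.
have [|x Px] := @zeros_prime_nonzero P (fun x => f1 x * f2 x) hP pP P1 (polyfun_mul hf1 hf2).
  by move=> /(pP _ _ hf1 hf2)[].
apply; have [/Y1E/(_ _ Sf1) ->|/Y2E/(_ _ Sf2) ->] := cov _ Px.
  by rewrite mul0r.
by rewrite mulr0.
Qed.

(** The top of the chain is the zero set of a prime ideal [P] over [J] that keeps [S] independent;
    the rest, obtained by induction, lies in a slice [x_s = c]. The slice is proper because
    [x_s - c], a nonzero function of [S], is not in [P]. *)
Lemma indep_zchain S J : poly_ideal J -> indep S (@one C n) J ->
  exists Z, zchain (zeros J) Z #|S|.
Proof.
move: {2}#|S| (erefl #|S|) => k; elim: k S J => [|k IH] S J Sk hJ ind;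
  have [P [hP JP indP pP]] := indep_prime hJ ind; have P1 : ~ P one;
  try by move/indep1P: indP; apply; [exact: polyS_const | exists (fun=> 0); exact/eqP/oner_neq0].
  rewrite Sk; exists (fun=> zeros P); split=> // i _.
  split; first exact: zeros_closed.
  by split; [exact: zeros_irreducible | move=> x Px g /JP/Px].
have [s sS] : exists s, s \in S by apply/set0Pn; rewrite -card_gt0 Sk.
have [c indc] := indep_cut Cunc hP (polyfun_const n 1) sS indP.
have hxs : polyfun (fun x : point C n => x s - c).
  by apply: polyfun_sub; [exact: polyfun_coord | exact: polyfun_const].
have hJ' := adjoin_ideal hP hxs.
have Sk' : #|S :\ s| = k by apply/eqP; rewrite -eqSS -Sk (cardsD1 s S) sS.
have [Z] := IH _ _ Sk' hJ' indc; rewrite Sk Sk' => -[Zirr Zinc].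
have ZP x : Z k x -> zeros P x /\ x s = c.
  have [_ [_ ZJ]] := Zirr k (leqnn k) => /ZJ Jx; split.
    by move=> g Pg; apply: Jx; exact: adjoin_incl.
  by apply/eqP; rewrite -subr_eq0; apply/eqP; apply: (Jx (fun x => x s - c)); exact: adjoin_gen.
exists (fun i => if (i <= k)%N then Z i else zeros P); split=> i.
  rewrite leq_eqVlt => /predU1P[->|]; rewrite ?ltnn.
    split; first exact: zeros_closed.
    by split; [exact: zeros_irreducible | move=> x Px g /JP/Px].
  rewrite ltnS => ik; rewrite ik; have [h1 [h2 h3]] := Zirr i ik.
  split=> //; split=> // x /h3 Jx g /JP Pg; apply: Jx; exact: adjoin_incl.
move=> ik1; have [->|ik] : i = k \/ (i < k)%N.
    by move: ik1; rewrite ltnS leq_eqVlt => /predU1P.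
  2: by rewrite ik (ltnW ik); exact: Zinc.
rewrite leqnn ltnn; split; first by move=> x /ZP[].
have [|x Px xs] := zeros_prime_nonzero hP pP P1 hxs.
  move/indep1P: indP; apply.
    apply: (@polyS_add _ _ _ (fun x => x s) (fun=> - c)); first exact: polyS_coord.
    exact: polyS_const.
  by exists (fun=> c + 1); apply/eqP; rewrite addrAC subrr add0r oner_neq0.
by exists x; split=> // /ZP[_ xc]; apply: xs; rewrite xc subrr.
Qed.

End ClosedField.

(** * Integral dependence and chains *)

Lemma sum_delta (C : pzRingType) (I : finType) (j : I) (F : I -> C) :
  \sum_l (j == l)%:R * F l = F j.
Proof.
rewrite (bigD1 j) //= eqxx mul1r big1 ?addr0 // => l.
by rewrite eq_sym => /negPf ->; rewrite mul0r.
Qed.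

Section IntegralDependence.
Variables (C : fieldType) (n : nat).
Hypothesis Cinf : forall k, exists s : seq C, uniq s /\ size s = k.
Implicit Types (f g h a : point C n -> C) (W Z : point C n -> Prop).
Implicit Types (S : {set 'I_n}) (x y : point C n).

(** Equivalently, the projection of [W] to the coordinates in [S] is Zariski dense. *)
Definition dense_on S W :=
  forall g, polyS S g -> (exists x, g x <> 0) -> exists2 x, W x & g x <> 0.

(* [a f], for some nonzero [a] in the ring [A] of polynomial functions of [S],
   is integral over [A] as a function on [W]: multiplication by [a f]
   preserves the [A]-module generated by a family [b] containing 1. *)
Definition integral_on S W f := exists a (I : finType) (i0 : I)
    (b : I -> point C n -> C) (H : I -> I -> point C n -> C),
  [/\ polyS S a, exists x, a x <> 0, forall i j, polyS S (H i j),
      forall x, b i0 x = 1 &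
      forall x, W x -> forall i, a x * f x * b i x = \sum_j H i j x * b j x].

Lemma integral_polyS S W f : polyS S f -> integral_on S W f.
Proof.
move=> hf; exists (fun=> 1), unit, tt, (fun _ _ => 1), (fun _ _ => f); split=> //.
- exact: polyS_const.
- by exists (fun=> 0); exact/eqP/oner_neq0.
- move=> x _ i; rewrite (bigD1 tt) //= big1 => [|[]//].
  by rewrite addr0 mul1r.
Qed.

(** On the products [b_i b'_j], multiplication by [a a' (f + g)] is given by the Kronecker sum of
    [a' H] and [a H']. *)
Lemma integral_add S W f g :
  integral_on S W f -> integral_on S W g -> integral_on S W (fun x => f x + g x).
Proof.
move=> [a [I [i0 [b [H [ha ax hH b1 eq]]]]]] [a' [I' [i0' [b' [H' [ha' ax' hH' b1' eq']]]]]].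
exists (fun x => a x * a' x), (I * I')%type, (i0, i0').
exists (fun p x => b p.1 x * b' p.2 x).
exists (fun p q x => (p.2 == q.2)%:R * (a' x * H p.1 q.1 x) +
                     (p.1 == q.1)%:R * (a x * H' p.2 q.2 x)); split.
- exact: polyS_mul.
- by apply: (polyfun_mul_neq0 Cinf) => //; [case: ha | case: ha'].
- move=> p q; apply: polyS_add; apply: polyS_mul; do ?exact: polyS_const;
    exact: polyS_mul.
- by move=> x; rewrite b1 b1' mulr1.
- move=> x Wx [i j] /=.
  rewrite -(pair_bigA _ (fun k l => ((j == l)%:R * (a' x * H i k x) +
     (i == k)%:R * (a x * H' j l x)) * (b k x * b' l x))) /=.
  transitivity (\sum_k (a' x * H i k x * b k x * b' j x) +
                \sum_l (a x * H' j l x * b i x * b' l x)).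
    transitivity (a' x * b' j x * (a x * f x * b i x) + a x * b i x * (a' x * g x * b' j x)).
      by ring.
    rewrite eq // eq' // !big_distrr; congr (_ + _); apply: eq_bigr => k _ /=; ring.
  under [RHS]eq_bigr => k _.
    under eq_bigr => l _ do rewrite mulrDl -!mulrA.
    rewrite big_split /= sum_delta; over.
  rewrite big_split /=; congr (_ + _); first by apply: eq_bigr => k _; ring.
  rewrite exchange_big; apply: eq_bigr => l _.
  by rewrite sum_delta; ring.
Qed.

Lemma integral_mul S W f g :
  integral_on S W f -> integral_on S W g -> integral_on S W (fun x => f x * g x).
Proof.
move=> [a [I [i0 [b [H [ha ax hH b1 eq]]]]]] [a' [I' [i0' [b' [H' [ha' ax' hH' b1' eq']]]]]].
exists (fun x => a x * a' x), (I * I')%type, (i0, i0').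
exists (fun p x => b p.1 x * b' p.2 x), (fun p q x => H p.1 q.1 x * H' p.2 q.2 x); split.
- exact: polyS_mul.
- by apply: (polyfun_mul_neq0 Cinf) => //; [case: ha | case: ha'].
- by move=> p q; apply: polyS_mul.
- by move=> x; rewrite b1 b1' mulr1.
- move=> x Wx [i j] /=.
  rewrite -(pair_bigA _ (fun k l => H i k x * H' j l x * (b k x * b' l x))) /=.
  transitivity ((a x * f x * b i x) * (a' x * g x * b' j x)); first by ring.
  rewrite eq // eq' // big_distrlr; apply: eq_bigr => k _; apply: eq_bigr => l _ /=.
  by ring.
Qed.

(** A nonzero function of [t |: S] vanishing on [W] is an equation for [x_t]. Its leading
    coefficient is taken as [a], and the powers of [x_t] below its degree as the family [b]. *)
Lemma integral_coord S W t : dense_on S W -> t \notin S -> ~ dense_on (t |: S) W ->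
  integral_on S W (fun x => x t).
Proof.
move=> dS tS /existsNP[g /not_implyP[hg /not_implyP[[x0 gx0] nd]]].
have gW x : W x -> g x = 0.
  by move=> Wx; apply: contrapT => gx; apply: nd; exists x.
have [P [[_ [d hd]] _ hP eP]] := polyS_upd Cinf hg tS.
have gP x : g x = (P x).[x t].
  by rewrite -eP; congr g; apply/funext => j; rewrite /upd; case: eqP => [->|].
pose nz k := `[< exists x, (P x)`_k <> 0 >].
have nzd k : nz k -> (k <= d)%N.
  move=> /asboolP[x xk]; rewrite leqNgt; apply/negP => dk; apply: xk.
  by rewrite nth_default // (leq_trans (hd x)) // ltnW.
have exnz : exists k, nz k.
  exists (size (P x0)).-1; apply/asboolP; exists x0; apply/eqP.
  by rewrite lead_coef_eq0; apply/eqP => P0; apply: gx0; rewrite gP P0 horner0.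
case: (ex_maxnP exnz nzd) => K /asboolP[x1 Kx1] Kmax.
have sP x : (size (P x) <= K.+1)%N.
  apply/leq_sizeP => j Kj; apply: contrapT => xj.
  by have := Kmax j; rewrite leqNgt Kj => /(_ (asboolT (ex_intro _ x xj))).
have gK x : g x = \sum_(i < K.+1) (P x)`_i * x t ^+ i.
  by rewrite gP (horner_coef_wide _ (sP x)).
case: K Kx1 {Kmax sP} gK => [|K] Kx1 gK.
  have [x Wx] := dS _ (hP 0%N) (ex_intro _ x1 Kx1).
  by have := gK x; rewrite gW // big_ord1 mulr1 => <-.
exists (fun x => (P x)`_K.+1), 'I_K.+1, ord0, (fun (i : 'I_K.+1) x => x t ^+ i).
(* The companion matrix times the leading coefficient, which clears the denominators of its last
   row. *)
exists (fun (i j : 'I_K.+1) x => if i == K :> nat then - 1 * (P x)`_j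
                     else (j == i.+1 :> nat)%:R * (P x)`_K.+1); split=> //.
- by exists x1.
- by move=> i j; case: eqP => _; apply: polyS_mul => //; exact: polyS_const.
- move=> x Wx i; rewrite -mulrA -exprS; case: eqP => [->|/eqP iK].
    under [RHS]eq_bigr => j _ do rewrite mulN1r mulNr.
    rewrite sumrN; apply/eqP; rewrite -addr_eq0 addrC; apply/eqP.
    by rewrite -[RHS](gW x Wx) gK [RHS]big_ord_recr.
  have iK1 : (i.+1 < K.+1)%N by rewrite ltnS ltn_neqAle iK -ltnS ltn_ord.
  rewrite (bigD1 (Ordinal iK1)) //= eqxx mul1r big1 ?addr0 // => j.
  by rewrite -val_eqE => /negPf /= ->; rewrite !mul0r.
Qed.

Lemma integral_polyfun S W f : dense_on S W ->
  (forall t, t \notin S -> ~ dense_on (t |: S) W) -> polyfun f -> integral_on S W f.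
Proof.
move=> dS nd; elim=> [c|i|f1 f2 _ h1 _ h2|f1 f2 _ h1 _ h2].
- exact/integral_polyS/polyS_const.
- have [iS|niS] := boolP (i \in S); first exact/integral_polyS/polyS_coord.
  by apply: integral_coord => //; exact: nd.
- exact: integral_add.
- exact: integral_mul.
Qed.

(** The vector of the [b_i(x)], nonzero because one entry is 1, is an eigenvector of [H(x)] for the
    eigenvalue [a(x) f(x)]; the characteristic polynomial of [H(x)] is the equation. *)
Lemma integral_equation S W f : integral_on S W f ->
  exists a (P : point C n -> {poly C}), [/\ polyS S a, exists x, a x <> 0,
    forall k, polyS S (fun x => (P x)`_k),
    exists d, forall x, P x \is monic /\ size (P x) = d.+1 &
    forall x, W x -> (P x).[a x * f x] = 0].
Proof.
move=> [a [I [i0 [b [H [ha ax hH b1 eq]]]]]].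
pose M x := \matrix_(i < #|I|, j < #|I|) H (enum_val j) (enum_val i) x.
exists a, (fun x => char_poly (M x)); split=> //.
- move=> k; split.
    have [] : polyfam (fun x => char_poly (M x)); last by move=> h _; exact: h.
    apply: polyfam_char_poly => i j; have [h _] := hH (enum_val j) (enum_val i).
    by congr polyfun: h; apply/funext => x; rewrite mxE.
  move=> x y xy; congr (_`_k); congr char_poly; apply/matrixP => i j; rewrite !mxE.
  by have [_] := hH (enum_val j) (enum_val i); apply.
- by exists #|I| => x; rewrite char_poly_monic size_char_poly.
- move=> x Wx; apply/eqP; rewrite -[_ == 0]/(root _ _) -eigenvalue_root_char.
  apply/eigenvalueP; exists (\row_i b (enum_val i) x).
    apply/rowP => i; rewrite !mxE eq //.
    rewrite (reindex (@enum_val I I)) /=; last first.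
      by exists enum_rank => j _; rewrite ?enum_valK ?enum_rankK.
    by apply: eq_bigr => j _; rewrite !mxE mulrC.
  apply/eqP => /rowP/(_ (enum_rank i0)); rewrite !mxE enum_rankK b1.
  by apply/eqP/oner_neq0.
Qed.

Lemma zclosed_zero f : polyfun f -> zclosed (fun x => f x = 0).
Proof.
move=> hf; exists (eq f); split=> [g <- //|x].
by split=> [fx g <- //|]; apply.
Qed.

Lemma zirreducible_prime W f g : zirreducible W -> polyfun f -> polyfun g ->
  (forall x, W x -> f x * g x = 0) ->
  (forall x, W x -> f x = 0) \/ (forall x, W x -> g x = 0).
Proof.
move=> [_ irr] hf hg fg.
apply: (irr _ _ (zclosed_zero hf) (zclosed_zero hg)) => x /fg/eqP.
by rewrite mulf_eq0 => /orP[] /eqP; [left | right].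
Qed.

(* Otherwise [f], which vanishes on [Z] but not on [W], satisfies an integral
   equation on [W]; after division by a power of [f] its constant term vanishes
   on [Z]. *)
Lemma dense_on_extend S Z W f : zirreducible W -> (forall x, Z x -> W x) ->
  dense_on S Z -> polyfun f -> (forall x, Z x -> f x = 0) ->
  (exists2 x, W x & f x <> 0) -> exists2 t, t \notin S & dense_on (t |: S) W.
Proof.
move=> irrW ZW dZ hf fZ [w Ww fw]; apply: contrapT => nex.
have dW : dense_on S W by move=> g hg /(dZ g hg)[x /ZW]; exists x.
have [|a [P [ha ax hP [d hd] eP]]] := integral_equation (integral_polyfun dW _ hf).
  by move=> t tS dt; apply: nex; exists t.
pose nz k := `[< exists x, (P x)`_k <> 0 >].
have exnz : exists k, nz k.
  exists d; apply/asboolP; exists w; apply/eqP; have [mP sP] := hd w.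
  by have := monicP mP; rewrite lead_coefE sP /= => ->; exact: oner_neq0.
case: (ex_minnP exnz) => k /asboolP knz kmin.
have Plow x i : (i < k)%N -> (P x)`_i = 0.
  move=> ik; apply: contrapT => xi.
  by have := kmin i (asboolT (ex_intro _ x xi)); rewrite leqNgt ik.
pose u x := a x * f x; have hu : polyfun u by apply: polyfun_mul => //; case: ha.
(* The quotient of [P(u)] by [u^k]; indices [k + i] beyond the degree [d] contribute zero
   coefficients. *)
pose R x := \sum_(i < d.+1) (P x)`_(k + i) * u x ^+ i.
have hR : polyfun R.
  apply: polyfun_sum => i; apply: polyfun_mul; first by case: (hP (k + i)%N).
  exact: polyfun_exp.
have PR x : (P x).[u x] = u x ^+ k * R x.
  have [_ sP] := hd x.
  rewrite (@horner_coef_wide _ (k + d.+1)) ?sP ?leq_addl // big_split_ord /=.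
  rewrite big1 ?add0r => [|i _]; last by rewrite Plow ?mul0r //.
  rewrite big_distrr; apply: eq_bigr => i _ /=; rewrite exprD; ring.
(* On the irreducible [W] the product [a f] is not identically zero: [a] is not, by density, and [f]
   is nonzero at [w]. *)
have u0 : ~ (forall x, W x -> u x ^+ k = 0).
  move=> u0; have uW x : W x -> a x * f x = 0.
    by move=> /u0/eqP; rewrite expf_eq0 => /andP[_ /eqP].
  have ha' : polyfun a by case: ha.
  have [aW|fW] := zirreducible_prime irrW ha' hf uW; last exact: fw (fW _ Ww).
  by have [x Wx] := dW _ ha ax; rewrite aW.
have [|/u0//|RW] := zirreducible_prime irrW (polyfun_exp k hu) hR.
  by move=> x Wx; rewrite -PR; exact: eP.
(* Density on [Z] gives a point where the constant term of [R] is nonzero, although [R] reduces to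
   it where [f = 0]. *)
have [x Zx px] := dZ _ (hP k) knz; apply: px.
have := RW x (ZW x Zx); rewrite /R big_ord_recl big1 => [|i _].
  by rewrite addr0 addn0 mulr1.
by rewrite /u (fZ x Zx) mulr0 expr0n mulr0.
Qed.

Lemma zchain_dense_on V (Z : nat -> point C n -> Prop) k :
  zchain V Z k -> exists2 S : {set 'I_n}, #|S| = k & dense_on S (Z k).
Proof.
elim: k => [|k IH] [Zirr Zinc].
  exists finset.set0; first exact: cards0.
  move=> g [_ dg] [x gx]; have [_ [[[z Zz] _] _]] := Zirr 0%N (leqnn 0).
  by exists z => //; rewrite (dg z x) // => i; rewrite inE.
have [|S Sk dS] := IH.
  by split=> i ik; [apply: Zirr; exact: leqW | apply: Zinc; exact: leqW].
have [[B [Bp ZB]] _] := Zirr k (leqnSn k).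
have [_ [irr _]] := Zirr k.+1 (leqnn _).
have [ZZ [x [Zx nZx]]] := Zinc k (leqnn _).
have /existsNP[f /not_implyP[Bf fx]] : ~ (forall f, B f -> f x = 0) by move/ZB.
have [||t tS dt] := dense_on_extend irr ZZ dS (Bp f Bf).
- by move=> y /ZB; apply.
- by exists x.
- by exists (t |: S)%SET => //; rewrite cardsU1 tS Sk.
Qed.

End IntegralDependence.

(** * Dimension *)

Section Dimension.
Variables (C : closedFieldType) (n : nat).
Hypothesis Cunc : forall phi : C -> nat, infinite_fiber phi.

Lemma zchain_trunc (V : point C n -> Prop) Z k q : (q <= k)%N -> zchain V Z k -> zchain V Z q.
Proof.
move=> qk [h1 h2]; split=> i iq; first by apply: h1; exact: leq_trans qk.
by apply: h2; exact: leq_trans qk.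
Qed.

Lemma zchain_zeros (J : (point C n -> C) -> Prop) q : poly_ideal J ->
  (exists Z, zchain (zeros J) Z q) <-> exists2 S : {set 'I_n}, #|S| = q & indep S one J.
Proof.
move=> hJ; split=> [[Z ZJ]|[S <-]]; last exact: indep_zchain.
have [S Sq dS] := zchain_dense_on (uncountable_infinite Cunc) ZJ.
exists S => //; apply/indep1P => g hg gx Jg.
have [x Zx] := dS _ hg gx; apply.
by have [_ [_ ZV]] := ZJ.1 q (leqnn q); exact: ZV.
Qed.

(** As [zdim] is defined by choice, a greatest chain length has to be exhibited: lengths are at most
    [n], and [~ J one] provides a chain of length 0. Truncating a longest chain gives all smaller
    [q]. *)
Lemma leq_zdim_zeros (J : (point C n -> C) -> Prop) q : poly_ideal J -> ~ J one ->
  (q <= zdim (zeros J))%N <-> exists2 S : {set 'I_n}, #|S| = q & indep S one J.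
Proof.
move=> hJ J1; rewrite -zchain_zeros //.
pose ch k := `[< exists Z, zchain (zeros J) Z k >].
have ch_le k : ch k -> (k <= n)%N.
  move=> /asboolP/zchain_zeros[//|S <- _].
  by rewrite -[X in (_ <= X)%N](card_ord n) max_card.
have ch0 : exists k, ch k.
  exists 0%N; apply/asboolP/zchain_zeros => //; exists finset.set0; first exact: cards0.
  apply/indep0P => // m; rewrite (_ : (fun x => _) = one) //.
  by apply/funext => x; rewrite expr1n.
have : is_zdim (zeros J) (zdim (zeros J)).
  apply: epsilon_spec; case: (ex_maxnP ch0 ch_le) => d /asboolP hd dmax.
  by exists d; split=> // Zd; have := dmax d.+1 (asboolT Zd); rewrite ltnn.
move: (zdim _) => d [[Z Zd] nd]; split=> [qd|[Z' Zq]].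
  by exists Z; exact: zchain_trunc Zd.
by rewrite leqNgt; apply/negP => dq; apply: nd; exists Z'; exact: zchain_trunc Zq.
Qed.

End Dimension.

(** * Linear algebra: nonzero minors and bases of spaces of functions *)

Section LinearAlgebra.
Variable C : fieldType.

(** Members of the family are taken as rows of a matrix of maximal rank. If the rank were below [r],
    a nonzero [l] would be orthogonal to all rows, and a member not orthogonal to [l] would raise
    the rank. *)
Lemma family_minor r (Vf : ('I_r -> C) -> Prop) :
  (forall l, (forall v, Vf v -> \sum_j v j * l j = 0) -> forall j, l j = 0) ->
  exists2 v : 'I_r -> 'I_r -> C, forall i, Vf (v i) & \det (\matrix_(i, j) v i j) != 0.
Proof.
move=> sep; pose rk q := `[< exists m (M : 'M[C]_(m, r)),
  (forall i, Vf (M i)) /\ \rank M = q >].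
have rk0 : exists q, rk q.
  by exists 0%N; apply/asboolP; exists 0%N, 0; split=> [[]//|]; rewrite mxrank0.
have rkr q : rk q -> (q <= r)%N by move=> /asboolP[m [M [_ <-]]]; exact: rank_leq_col.
case: (ex_maxnP rk0 rkr) => q /asboolP[m [M [VM Mq]]] qmax.
have Mfull : row_full M.
  rewrite /row_full Mq eqn_leq rkr /=; last by apply/asboolP; exists m, M.
  rewrite leqNgt; apply/negP => qr.
  have /rowV0Pn[l /sub_kermxP lM l0] : kermx M^T != 0.
    by rewrite kermx_eq0 -row_leq_rank -ltnNge mxrank_tr Mq.
  have /existsNP[v /not_implyP[Vv vl]] : ~ forall v, Vf v -> \sum_j v j * l 0 j = 0.
    by move=> /sep h; move: l0 => /eqP; apply; apply/rowP => j; rewrite h mxE.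
  pose w := \row_j v j.
  have ltM : (M < col_mx M w)%MS.
    have := submx_refl (col_mx M w); rewrite ltmxE col_mx_sub => /andP[-> _] /=.
    rewrite col_mx_sub submx_refl /=; apply/negP => /submxP[u wu]; apply: vl.
    have : w *m l^T = 0 by rewrite wu -mulmxA -[M *m _]trmxK trmx_mul trmxK lM trmx0 mulmx0.
    move=> /matrixP/(_ 0 0); rewrite !mxE => e; rewrite -[RHS]e.
    by apply: eq_bigr => j _; rewrite !mxE.
  suff /qmax : rk (\rank (col_mx M w)) by rewrite leqNgt -Mq rank_ltmx.
  apply/asboolP; exists (m + 1)%N, (col_mx M w); split=> // i.
  rewrite -(splitK i); case: (split i) => j /=.
    by congr Vf: (VM j); apply/funext => k; rewrite col_mxEu.
  by congr Vf: Vv; apply/funext => k; rewrite col_mxEd mxE.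
exists (fun i => M (fullrankfun Mfull i)) => [i|]; first exact: VM.
have := fullrowsub_unit Mfull; rewrite unitmxE unitfE.
by congr (\det _ != 0); apply/matrixP => i j; rewrite !mxE.
Qed.

Variable n : nat.

(** A free family in [E] of maximal length is taken; adding [g] creates a relation, in which [g] has
    a nonzero coefficient by freeness. *)
Lemma subspace_basis k (E : (point C n -> C) -> Prop) :
  (forall g, E g -> monomial_span k g) ->
  exists r (b : 'I_r -> point C n -> C), [/\ forall i, E (b i),
    forall l : 'I_r -> C, (forall x, \sum_i l i * b i x = 0) -> forall i, l i = 0 &
    forall g, E g -> exists l : 'I_r -> C, forall x, g x = \sum_i l i * b i x].
Proof.
move=> Ek; pose free r (b : 'I_r -> point C n -> C) :=
  forall l : 'I_r -> C, (forall x, \sum_i l i * b i x = 0) -> forall i, l i = 0.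
pose fr r := `[< exists b : 'I_r -> point C n -> C, (forall i, E (b i)) /\ free r b >].
have fr0 : exists r, fr r.
  by exists 0%N; apply/asboolP; exists (fun _ _ => 0); split=> [[]//|? ? []].
have frk r : fr r -> (r <= k)%N.
  move=> /asboolP[b [Eb fb]]; rewrite leqNgt; apply/negP => kr.
  case: r kr b Eb fb => // r kr b Eb fb.
  have [|l [i li] /fb lb] := @monomial_span_dependent _ _ r b; last exact: li (lb i).
  by move=> i; apply: (monomial_span_mono (N := k)) => //; exact: Ek.
case: (ex_maxnP fr0 frk) => r /asboolP[b [Eb fb]] rmax.
exists r, b; split=> // g Eg.
pose b' (i : 'I_r.+1) := if unlift ord0 i is Some j then b j else g.
have b'0 : b' ord0 = g by rewrite /b' unlift_none.
have b'S j : b' (lift ord0 j) = b j by rewrite /b' liftK.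
have /existsNP[l /not_implyP[lb /existsNP[i li]]] : ~ free r.+1 b'.
  move=> fb'; suff /rmax : fr r.+1 by rewrite ltnn.
  by apply/asboolP; exists b'; split=> // i; rewrite /b'; case: unlift.
have l0 : l ord0 != 0.
  apply/eqP => l0; apply: li; case: (unliftP ord0 i) => [j ->|-> //].
  apply: (fb (fun j => l (lift ord0 j))) => x; rewrite -[RHS](lb x).
  rewrite big_ord_recl l0 mul0r add0r.
  by apply: eq_bigr => m _; rewrite b'S.
exists (fun j => - (l ord0)^-1 * l (lift ord0 j)) => x.
apply: (mulfI l0); rewrite big_distrr /=; apply/eqP; rewrite -subr_eq0 -sumrN; apply/eqP.
rewrite -[RHS](lb x) big_ord_recl b'0; congr (_ + _).
apply: eq_bigr => j _; rewrite b'S; field; exact: l0.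
Qed.

End LinearAlgebra.

(** * Minimal invariant varieties *)

Section Derivations.
Variables (C : fieldType) (n : nat) (X : point C n -> Prop).
Variable F : ((Xpoint X -> C) -> (Xpoint X -> C)) -> Prop.
Hypothesis Fder : forall d, F d -> derivation d.
Implicit Types (f g : Xpoint X -> C).

(** The newest derivation is applied first, so that induction passes from [f] to [d f], as
    invariance of an ideal does. *)
Inductive diff_op : ((Xpoint X -> C) -> (Xpoint X -> C)) -> Prop :=
| diff_op_id : diff_op id
| diff_op_comp d D : F d -> diff_op D -> diff_op (D \o d).

Lemma Xpoint_inj (y x : Xpoint X) : proj1_sig y = proj1_sig x -> y = x.
Proof. by case: y x => y Xy [z Xz] /= yz; exact: eq_exist. Qed.

Lemma regular_const c : regular (fun _ : Xpoint X => c).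
Proof. by exists (fun=> c); split=> //; exact: polyfun_const. Qed.

Lemma regular_add f g : regular f -> regular g -> regular (fun x => f x + g x).
Proof.
move=> [p [hp fp]] [q [hq gq]]; exists (fun x => p x + q x).
by split=> [|x]; [exact: polyfun_add | rewrite fp gq].
Qed.

Lemma regular_mul f g : regular f -> regular g -> regular (fun x => f x * g x).
Proof.
move=> [p [hp fp]] [q [hq gq]]; exists (fun x => p x * q x).
by split=> [|x]; [exact: polyfun_mul | rewrite fp gq].
Qed.

Lemma regular_sum (I : Type) (r : seq I) (E : I -> Xpoint X -> C) :
  (forall i, regular (E i)) -> regular (fun x => \sum_(i <- r) E i x).
Proof.
move=> /choice[p hp]; exists (fun x => \sum_(i <- r) p i x); split.
  by apply: polyfun_sum => i; case: (hp i).
by move=> x; apply: eq_bigr => i _; case: (hp i).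
Qed.

Lemma regular_prod (I : Type) (r : seq I) (E : I -> Xpoint X -> C) :
  (forall i, regular (E i)) -> regular (fun x => \prod_(i <- r) E i x).
Proof.
move=> /choice[p hp]; exists (fun x => \prod_(i <- r) p i x); split.
  by apply: polyfun_prod => i; case: (hp i).
by move=> x; apply: eq_bigr => i _; case: (hp i).
Qed.

Lemma regular_det r (M : 'I_r -> 'I_r -> Xpoint X -> C) :
  (forall i j, regular (M i j)) -> regular (fun x => \det (\matrix_(i, j) M i j x)).
Proof.
move=> hM; rewrite /determinant; apply: regular_sum => s.
apply: regular_mul; first exact: regular_const.
rewrite (_ : (fun x => _) = fun x => \prod_i M i (s i) x); first exact: regular_prod.
by apply/funext => x; apply: eq_bigr => i _; rewrite mxE.
Qed.

Lemma diff_op_regular D f : diff_op D -> regular f -> regular (D f).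
Proof.
move=> hD; elim: hD f => // d D' /Fder[dr _] _ IH f /dr; exact: IH.
Qed.

Lemma diff_op_add D f g : diff_op D -> regular f -> regular g ->
  D (fun x => f x + g x) = fun x => D f x + D g x.
Proof.
move=> hD; elim: hD f g => // d D' /Fder[dr [dD _]] _ IH f g hf hg /=.
by rewrite dD // IH //; exact: dr.
Qed.

Lemma diff_op_scale D c f : diff_op D -> regular f ->
  D (fun x => c * f x) = fun x => c * D f x.
Proof.
move=> hD; elim: hD f => // d D' /Fder[dr [_ [dZ _]]] _ IH f hf /=.
by rewrite dZ // IH //; exact: dr.
Qed.

Lemma diff_op0 D (x : Xpoint X) : diff_op D -> D (fun=> 0) x = 0.
Proof.
move=> hD; have e := diff_op_scale 0 hD (regular_const 0).
transitivity (D (fun _ : Xpoint X => 0 * 0) x); last by rewrite e mul0r.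
by congr (D _ x); apply/funext => y; rewrite mul0r.
Qed.

Lemma diff_op_sum D r (l : 'I_r -> C) (E : 'I_r -> Xpoint X -> C) x : diff_op D ->
  (forall i, regular (E i)) -> D (fun x => \sum_i l i * E i x) x = \sum_i l i * D (E i) x.
Proof.
move=> hD hE; elim: (index_enum _) => [|i s IH].
  transitivity (D (fun _ : Xpoint X => 0) x); last by rewrite big_nil diff_op0.
  by congr (D _ x); apply/funext => y; rewrite big_nil.
have hi j : regular (fun x => l j * E j x) by apply: regular_mul => //; exact: regular_const.
rewrite big_cons -IH (_ : (fun x => _) =
    fun x => l i * E i x + \sum_(i <- s) l i * E i x); last first.
  by apply/funext => y; rewrite big_cons.
by rewrite diff_op_add ?diff_op_scale //; exact: regular_sum.
Qed.

Definition flat_at x f := regular f /\ forall D, diff_op D -> D f x = 0.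

(** By the Leibniz rule [D (d (g f)) = D (g d f) + D (f d g)], where [f] and [d f] are annihilated
    at [x] by the composites in question; induction is on the length, for all pairs [f], [g]. *)
Lemma flat_at_ideal (x : Xpoint X) : ideal (flat_at x).
Proof.
split; first by move=> f [].
split; first by split; [exact: regular_const | move=> D; exact: diff_op0].
split.
  move=> f g [hf Df] [hg Dg]; split; first exact: regular_add.
  by move=> D hD; rewrite diff_op_add // Df // Dg // addr0.
move=> f g hg [hf Df]; split; first exact: regular_mul.
move=> D hD; elim: hD f g hg hf Df => [|d D' Fd hD' IH] f g hg hf Df /=.
  by rewrite (Df _ diff_op_id) mulr0.
have [dr [_ [_ dM]]] := Fder Fd.
rewrite dM // diff_op_add //; try by apply: regular_mul => //; exact: dr.
rewrite IH //; last by move=> E hE; exact: Df (diff_op_comp Fd hE).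
  rewrite add0r (_ : (fun x => _) = fun x => d g x * f x).
    by rewrite IH //; exact: dr.
  by apply/funext => y; rewrite mulrC.
exact: dr.
Qed.

(** Composites of derivations preserve an invariant ideal, so their values on it vanish at [x];
    conversely, the flat functions themselves form an invariant ideal of functions vanishing at
    [x]. *)
Lemma inv_ideal_point (x : Xpoint X) f : inv_ideal F (fun y => y = proj1_sig x) f <-> flat_at x f.
Proof.
split=> [[I [[Ireg _] [Ivan [Iinv If]]]]|hf].
  split; first exact: Ireg.
  move=> D hD; elim: hD f If => [f /Ivan[_]|d D' Fd _ IH f If]; first exact.
  exact/IH/Iinv.
exists (flat_at x); split; first exact: flat_at_ideal.
split=> [g [hg Dg]|].
  by split=> // y /Xpoint_inj ->; exact: (Dg _ diff_op_id).
split=> // d g Fd [hg Dg]; split; first by case: (Fder Fd) => dr _; exact: dr.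
by move=> D hD; exact: Dg (diff_op_comp Fd hD).
Qed.

Definition restrict (g : point C n -> C) (x : Xpoint X) := g (proj1_sig x).

Lemma restrict_regular (g : point C n -> C) : polyfun g -> regular (restrict g).
Proof. by exists g. Qed.

(** The preimage of [I(F,x)] in the ring of polynomial functions on the ambient space. *)
Definition flat_poly (x : point C n) (g : point C n -> C) :=
  polyfun g /\ inv_ideal F (fun y => y = x) (restrict g).

Lemma flat_polyP (x : Xpoint X) (g : point C n -> C) : flat_poly (proj1_sig x) g <->
  polyfun g /\ forall D, diff_op D -> D (restrict g) x = 0.
Proof.
rewrite /flat_poly inv_ideal_point; split=> -[hg]; first by case.
by move=> Dg; split=> //; split=> //; exact: restrict_regular.
Qed.

Lemma flat_poly_ideal (x : Xpoint X) : poly_ideal (flat_poly (proj1_sig x)).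
Proof.
have [_ [I0 [ID IM]]] := flat_at_ideal x; rewrite /flat_poly; split.
- by move=> g [].
- by split; [exact: polyfun_const | apply/inv_ideal_point].
- move=> f g [hf /inv_ideal_point Ff] [hg /inv_ideal_point Fg]; split; first exact: polyfun_add.
  by apply/inv_ideal_point; exact: ID.
- move=> f g hg [hf /inv_ideal_point Ff]; split; first exact: polyfun_mul.
  by apply/inv_ideal_point; apply: IM => //; exact: restrict_regular.
Qed.

Lemma flat_poly_one (x : Xpoint X) : ~ flat_poly (proj1_sig x) one.
Proof. by move=> /flat_polyP[_ /(_ _ diff_op_id)/eqP]; rewrite oner_eq0. Qed.

(** Equations of [X] restrict to zero and so belong to the preimage ideal, whose zeros in the
    ambient space therefore lie in [X]. *)
Lemma min_inv_variety_zeros (x : Xpoint X) : zclosed X ->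
  min_inv_variety F (fun y => y = proj1_sig x) = zeros (flat_poly (proj1_sig x)).
Proof.
move=> [B [Bp XB]]; apply/predeqP => y; split=> [[Xy hy] g [_ /hy]//|hy].
have Xy : X y.
  apply/XB => f Bf; apply: hy; apply/flat_polyP; split; first exact: Bp.
  move=> D hD; transitivity (D (fun _ : Xpoint X => 0) x); last exact: diff_op0.
  by congr (D _ x); apply/funext => z; apply: (XB _).1 Bf; exact: proj2_sig.
exists Xy => f If; have [[p [hp fp]] _] := (inv_ideal_point x f).1 If.
rewrite fp /=; apply: hy; split=> //; congr (inv_ideal F _ _): If.
by apply/funext => z; rewrite fp.
Qed.

(** The set [O(S,k)]; the bound [k] is on codes of monomials. *)
Definition indep_locus (S : {set 'I_n}) k (x : point C n) := X x /\
  forall g : point C n -> C,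
    polyS S g -> monomial_span k g -> (exists y, g y <> 0) -> ~ flat_poly x g.

Lemma indep_locusP S (x : Xpoint X) :
  indep S one (flat_poly (proj1_sig x)) <-> forall k, indep_locus S k (proj1_sig x).
Proof.
rewrite indep1P; split=> [ind k|h g hg gx].
  by split=> [|g hg _ gx]; [exact: proj2_sig | exact: ind].
by have [k kg] := polyfun_monomial_span hg.1; exact: (h k).2.
Qed.

(* On a basis [b] of the functions concerned, independence at [x] means that
   some determinant of the values [D_i b_j] does not vanish at [x]. *)
Lemma indep_locus_open S k : zopen_in X (indep_locus S k).
Proof.
pose E (g : point C n -> C) := polyS S g /\ monomial_span k g.
have [|r [b [Eb fb gb]]] := @subspace_basis _ n k E; first by move=> g [].
have hb j : regular (restrict (b j)) by apply/restrict_regular; case: (Eb j) => -[].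
pose B (p : point C n -> C) := polyfun p /\
  exists2 D : 'I_r -> _, forall i, diff_op (D i) &
    forall x, p (proj1_sig x) = \det (\matrix_(i, j) D i (restrict (b j)) x).
exists (fun y => forall p, B p -> p y = 0); split.
  by exists B; split=> // p [].
move=> y; split=> [[Xy indy]|[Xy nB]]; last first.
  have /existsNP[p /not_implyP[[hp [D hD pD]] py]] := nB.
  split=> // g hg kg gx; rewrite -[y]/(proj1_sig (exist X y Xy)) => /flat_polyP[_ Dg].
  have [l gl] := gb g (conj hg kg).
  pose M := \matrix_(i, j) D i (restrict (b j)) (exist X y Xy).
  have Mu : M \in unitmx.
    by rewrite unitmxE unitfE -pD; exact/eqP.
  (* Flatness of [g = sum l_j b_j] makes [M] kill the coefficients; invertibility of [M] then forces
     [g = 0]. *)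
  have Ml : M *m \col_j l j = 0.
    apply/matrixP => i j; rewrite !mxE -[RHS](Dg (D i)) //.
    rewrite (_ : restrict g = fun x => \sum_j l j * restrict (b j) x).
      by rewrite diff_op_sum //; apply: eq_bigr => m _; rewrite !mxE mulrC.
    by apply/funext => x; rewrite /restrict gl.
  have /matrixP l0 : \col_j l j = 0 by rewrite -(mulKmx Mu (\col_j l j)) Ml mulmx0.
  case: gx => x; apply; rewrite gl big1 // => j _.
  by have := l0 j 0; rewrite !mxE => ->; rewrite mul0r.
split=> // By; pose x := exist X y Xy.
(* A vector [l] orthogonal to all the vectors of values [D b_j (x)] gives a flat combination of the
   [b_j], which independence at [x] forces to be zero. *)
have [|v Vv] := @family_minor C r
    (fun v => exists2 D, diff_op D & v = fun j => D (restrict (b j)) x).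
  move=> l hl; apply: fb => z; apply: contrapT => lz.
  pose g (z : point C n) := \sum_i l i * b i z.
  have hg : polyS S g.
    by apply: polyS_sum => i; apply: polyS_mul; [exact: polyS_const | case: (Eb i)].
  have kg : monomial_span k g.
    have /choice[a ha] i : exists a : nat -> C, forall x,
        b i x = \sum_(m < k) a m * monomial_nat m x by case: (Eb i).
    exists (fun m => \sum_i l i * a i m) => t.
    rewrite /g; under eq_bigr => i _ do rewrite ha big_distrr.
    rewrite exchange_big; apply: eq_bigr => m _ /=.
    by rewrite big_distrl; apply: eq_bigr => i _; rewrite /= mulrA.
  apply: (indy g hg kg); first by exists z.
  rewrite -[y]/(proj1_sig x); apply/flat_polyP; split; first by case: hg.
  move=> D hD; rewrite (_ : restrict g = fun x => \sum_j l j * restrict (b j) x) //.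
  rewrite diff_op_sum //; apply: etrans (hl (fun j => D (restrict (b j)) x) _).
    by apply: eq_bigr => j _; rewrite mulrC.
  by exists D.
have /choice[D hD] i : exists D, diff_op D /\ v i = fun j => D (restrict (b j)) x.
  by have [D] := Vv i; exists D.
have [|p [hp pE]] := @regular_det r (fun i j => D i (restrict (b j))).
  by move=> i j; apply: diff_op_regular => //; case: (hD i).
have -> : \det (\matrix_(i, j) v i j) = p y.
  rewrite -[y]/(proj1_sig x) -pE; congr (\det _); apply/matrixP => i j.
  by rewrite !mxE; case: (hD i) => _ ->.
move=> /eqP; apply; apply: By; split=> //; exists D => [i|]; first by case: (hD i).
by move=> z; rewrite pE.
Qed.

End Derivations.

(** * Countable operations in a sigma-algebra *)

Section SigmaAlgebra.
Variables (C : fieldType) (n : nat) (X : point C n -> Prop).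
Variable M : (point C n -> Prop) -> Prop.
Hypothesis hM : sigma_algebra_on X M.

Lemma sigma_compl A : M A -> M (fun x => X x /\ ~ A x).
Proof. by case: hM => _ [_ [h _]]; exact: h. Qed.

Lemma sigma_bigcap (A : nat -> point C n -> Prop) :
  (forall k, M (A k)) -> M (fun x => forall k, A k x).
Proof.
move=> MA; have [MX [_ [_ MU]]] := hM.
have := sigma_compl (MU _ (fun k => sigma_compl (MA k))).
congr M; apply/predeqP => x; split=> [[Xx h] k|h].
  by apply: contrapT => nA; apply: h; exists k.
by split=> [|[k [_]]]; [exact: MX (MA 0%N) _ (h 0%N) | apply].
Qed.

Lemma sigma_set0 : M (fun=> False).
Proof.
have [_ [MX _]] := hM; have := sigma_compl MX.
by congr M; apply/predeqP => x; split=> // -[].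
Qed.

Lemma sigma_countable_union (T : countType) (A : T -> point C n -> Prop) :
  (forall t, M (A t)) -> M (fun x => exists t, A t x).
Proof.
move=> MA; have [_ [_ [_ MU]]] := hM.
pose A' (k : nat) := if @unpickle T k is Some t then A t else fun=> False.
have MA' k : M (A' k) by rewrite /A'; case: unpickle => [t|]; [exact: MA | exact: sigma_set0].
congr M: (MU A' MA'); apply/predeqP => x; rewrite /A'; split=> [[k]|[t At]].
  by case: unpickle => [t At|//]; exists t.
by exists (pickle t); rewrite pickleK.
Qed.

End SigmaAlgebra.

(** * Measurability of the dimension and its very generic value *)

Theorem theorem1 (R : realType) (n : nat) (X : point R[i] n -> Prop)
  (F : ((Xpoint X -> R[i]) -> (Xpoint X -> R[i])) -> Prop) :
  affine_variety X -> foliation F ->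
  zariski_measurable X (nF F) /\
  exists p : nat,
    (forall x, X x -> (nF F x <= p)%N) /\
    very_generic X (fun x => nF F x = p).
Proof.
move=> [Xcl [[x0 Xx0] _]] [Fder _].
pose L := indep_locus F (n := n).
have leq_nF x q : X x ->
    (q <= nF F x)%N <-> exists2 S : {set 'I_n}, #|S| = q & forall k, L S k x.
  move=> Xx; pose y : Xpoint X := exist X x Xx.
  rewrite /nF -[x]/(proj1_sig y) min_inv_variety_zeros //.
  rewrite (leq_zdim_zeros (@complex_infinite_fiber R)); last 2 first.
  - exact: flat_poly_ideal.
  - exact: flat_poly_one.
  by split=> -[S Sq /indep_locusP h]; exists S => //; apply/indep_locusP.
split.
  move=> k M hM Mopen.
  (* A superlevel set is a finite union, over the sets [S] of cardinality [q], of countable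
     intersections of open sets. *)
  have Mge q : M (fun x => X x /\ (q <= nF F x)%N).
    pose A (T : {S : {set 'I_n} | #|S| == q}) x := forall k, L (val T) k x.
    have MA T : M (A T) by apply: (sigma_bigcap hM) => j; exact/Mopen/indep_locus_open.
    congr M: (sigma_countable_union hM MA); apply/predeqP => x.
    split=> [[[S Sq] /= h]|[Xx /(leq_nF _ _ Xx)[S Sq h]]].
      by have Xx := (h 0%N).1; split=> //; apply/leq_nF => //; exists S => //; exact/eqP.
    by exists (Sub S (introT eqP Sq)).
  (* The fibre over [k] is [{k <= nF}] minus [{k < nF}], written as a countable intersection by
     repeating the second condition. *)
  pose A (i : nat) := if i is 0%N then fun x => X x /\ (k <= nF F x)%N
    else fun x => X x /\ ~ (X x /\ (k < nF F x)%N).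
  have MA i : M (A i).
    by case: i => [|i]; [exact: Mge | exact: (sigma_compl hM (Mge _))].
  congr M: (sigma_bigcap hM MA); apply/predeqP => x; split=> [h|[Xx e] [|i]]; last 2 first.
  - by rewrite /A e.
  - by split=> // -[_]; rewrite e ltnn.
  have [Xx kx] := h 0%N; have [_ nk] := h 1%N; split=> //.
  by apply/eqP; rewrite eqn_leq kx andbT leqNgt; apply/negP => kx'; apply: nk.
(* Each locus is asked to be nonempty, with no common point; [p] will be the largest such [q]. *)
pose gen q := `[< exists2 S : {set 'I_n}, #|S| = q & forall k, exists x, L S k x >].
have gen_nF x q : X x -> (q <= nF F x)%N -> gen q.
  move=> Xx /(leq_nF _ _ Xx)[S Sq h]; apply/asboolP; exists S => // k; by exists x.
have gen0 : exists q, gen q by exists 0%N; exact: gen_nF Xx0 _.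
have gen_le q : gen q -> (q <= n)%N.
  by move=> /asboolP[S <- _]; rewrite -[X in (_ <= X)%N](card_ord n) max_card.
case: (ex_maxnP gen0 gen_le) => p /asboolP[S Sp Sgen] pmax; exists p.
have nF_le x : X x -> (nF F x <= p)%N by move=> Xx; apply: pmax; exact: gen_nF Xx _.
(* The loci of the chosen [S] are the open sets sought: on their intersection the dimension is at
   least [p]. *)
split=> //; exists (L S); split=> [k|x Xx h].
  by split; [exact: indep_locus_open | exact: Sgen].
by apply/eqP; rewrite eqn_leq nF_le //=; apply/leq_nF => //; exists S.
Qed.
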